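(* Let $\mathcal{Q}$ be the space of quadrilaterals modulo similarity, regarded as a subset of $\mathbb{R}^4$ via the parameterization in the context. There is an open set in $\mathcal{Q}$ containing the rectangle line $\{(a,b,c,d)\in\mathcal{Q}: a=c,\ b=d,\ a+b=\pi/2\}$ that is contained in the union of finitely many orbit tiles.
   Context: Parameterization: a quadrilateral is cut by a diagonal into two triangles. The four angles $(a,b,c,d)$ that the diagonal makes with the four sides (the angles of the two triangles at the endpoints of the diagonal) determine the quadrilateral up to similarity, and $\mathcal{Q}$ carries the subspace topology from $\mathbb{R}^4$. Rectangles correspond exactly to the rectangle line above. A billiard path in a polygon is a straight-line trajectory inside the polygon that reflects off the sides with angle of incidence equal to angle of reflection. Trajectories hitting vertices are excluded. It is periodic if it repeats itself. The sides of a quadrilateral are labelled $0,1,2,3$. The orbit type of a periodic billiard path is the word recording the labels of the sides hit during one period. If this word has odd length, the orbit type is its square. For a word $W$, the orbit tile $O(W)$ is the set of quadrilaterals in $\mathcal{Q}$ having a periodic billiard path of orbit type $W$. *)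

(* Defs.v *)
From Stdlib Require Import Reals Lra List Arith.
Open Scope R_scope.

Definition pt := (R * R)%type.
Definition padd (x y : pt) : pt := (fst x + fst y, snd x + snd y).
Definition psub (x y : pt) : pt := (fst x - fst y, snd x - snd y).
Definition pscale (k : R) (x : pt) : pt := (k * fst x, k * snd x).
Definition pdot (x y : pt) : R := fst x * fst y + snd x * snd y.
Definition lerp (x y : pt) (t : R) : pt := padd (pscale (1 - t) x) (pscale t y).

Definition reflect (e v : pt) : pt :=
  psub (pscale (2 * pdot v e / pdot e e) e) v.

(** Parameterization of the quadrilateral (up to similarity) by (a,b,c,d).
    The diagonal is P=(0,0) -- R=(1,0).  Triangle PQR lies below the diagonal,
    with angle a at P and angle b at R; triangle PRS lies above the diagonal,
    with angle c at R and angle d at P.  (With this convention rectangles are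
    exactly a=c, b=d, a+b=pi/2.)  Vertices in cyclic order P,Q,R,S. *)
Definition vP : pt := (0, 0).
Definition vR : pt := (1, 0).
Definition vQ (a b : R) : pt :=
  pscale (sin b / sin (a + b)) (cos a, - sin a).
Definition vS (c d : R) : pt :=
  pscale (sin c / sin (c + d)) (cos d, sin d).

Definition vert (a b c d : R) (i : nat) : pt :=
  match i mod 4 with
  | 0%nat => vP
  | 1%nat => vQ a b
  | 2%nat => vR
  | _ => vS c d
  end.

Definition side_dir (a b c d : R) (s : nat) : pt :=
  psub (vert a b c d (S s)) (vert a b c d s).

(** The space Q of quadrilaterals modulo similarity, as a subset of R^4:
    positive angles, each triangle nondegenerate, and no straight angle at
    the endpoints P, R of the diagonal. *)
Definition inQ (a b c d : R) : Prop :=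
  0 < a /\ 0 < b /\ 0 < c /\ 0 < d /\ a + b < PI /\ c + d < PI /\
  a + d <> PI /\ b + c <> PI.

Definition rect_line (a b c d : R) : Prop :=
  inQ a b c d /\ a = c /\ b = d /\ a + b = PI / 2.

Definition in_open_tri (A B C z : pt) : Prop :=
  exists al be ga, 0 < al /\ 0 < be /\ 0 < ga /\ al + be + ga = 1 /\
    z = padd (padd (pscale al A) (pscale be B)) (pscale ga C).

Definition in_interior (a b c d : R) (z : pt) : Prop :=
  in_open_tri vP (vQ a b) vR z \/ in_open_tri vP vR (vS c d) z \/
  (exists t, 0 < t < 1 /\ z = lerp vP vR t).

Definition periodic_billiard_path (a b c d : R) (n : nat)
    (s : nat -> nat) (x : nat -> pt) : Prop :=
  (0 < n)%nat /\
  (forall i, s (i + n)%nat = s i /\ x (i + n)%nat = x i) /\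
  (forall i, (s i < 4)%nat /\
     exists u, 0 < u < 1 /\ x i = lerp (vert a b c d (s i)) (vert a b c d (S (s i))) u) /\
  (forall i t, 0 < t < 1 -> in_interior a b c d (lerp (x i) (x (S i)) t)) /\
  (forall i, exists lam, 0 < lam /\
     psub (x (S (S i))) (x (S i)) =
     pscale lam (reflect (side_dir a b c d (s (S i))) (psub (x (S i)) (x i)))) /\
  (forall k, (0 < k < n)%nat -> exists i, x (i + k)%nat <> x i).

Definition orbit_word (n : nat) (s : nat -> nat) : list nat :=
  map s (seq 0 (if Nat.even n then n else 2 * n)).

Definition in_orbit_tile (W : list nat) (a b c d : R) : Prop :=
  inQ a b c d /\
  exists n s x, periodic_billiard_path a b c d n s x /\ orbit_word n s = W.

Definition open4 (V : R -> R -> R -> R -> Prop) : Prop :=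
  forall a b c d, V a b c d -> exists eps, 0 < eps /\
    forall a' b' c' d', Rabs (a' - a) < eps -> Rabs (b' - b) < eps ->
      Rabs (c' - c) < eps -> Rabs (d' - d) < eps -> V a' b' c' d'.

(* Main.v *)
Require Import Defs.
From Stdlib Require Import Reals Lra Lia Psatz List Arith Classical.
Open Scope R_scope.

(* Call a vertex acute or obtuse according to the sign of its angle minus [PI / 2];
   these four defects sum to zero.  Close to a rectangle one of the following holds.
   - All defects vanish: bounce between the midpoints of two opposite sides.
   - Two opposite vertices are acute: there is a path of eight bounces along their
     diagonal, made of common tangents of circles centred at the two vertices.
   - Some acute vertex, of defect [- delta], has a neighbour of defect
     [c <= delta / 2] ([c < 0] being allowed).  Then a path runs along the side
     joining them.  For [c < 0] it is the Fagnano path of the triangle cut out by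
     three side lines.  For [c >= 0] it is a path that retraces itself, of one of
     five kinds for [c = 0], [0 < c < delta / 3], [c = delta / 3],
     [delta / 3 < c < delta / 2] and [c = delta / 2].
   In the last two cases the path stays at a distance from the diagonal or side of
   the order of the defects, so it misses the remaining vertices when the defects
   are small.  All paths have at most 28 bounces, so finitely many words suffice. *)

(** * Legs and bounces *)

(** The bound [c <= delta / 2] comes from the zero sum of the defects: if exactly one vertex is
    acute, the other three defects are nonnegative and add up to [delta], so one of its two
    neighbours has at most half of it. A path along a side is described in polar coordinates about
    the point where the lines of the two adjacent sides meet. A bounce off one of these keeps the
    distance of the leg from that point and mirrors the angle of its normal. So a path is a list of
    angles, and only bounces off the third side relate different distances. The path exists if an
    interval of distances is nonempty. For the two generic kinds with [0 < c] this interval closes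
    up as [c] tends to [0], [delta / 3] or [delta / 2], which is why these values have paths of
    their own. The rectangle line is not compact, so finiteness does not come from a covering
    argument: the size of the neighbourhood depends on the rectangle, the bound on the number of
    bounces does not. *)

Definition cross (x y : pt) : R := fst x * snd y - snd x * fst y.

(* A leg of a path is encoded by the affine function [z |-> lgrad . z - loff]
   vanishing on it; [lside] is the side that the leg hits at its end. *)
Record leg := Leg { lside : nat; lgrad : pt; loff : R }.
Definition leval (l : leg) (z : pt) : R := pdot (lgrad l) z - loff l.

(* The next leg [l'] has the affine function [- (leval l) o r], where [r] is the
   reflection in the side hit by [l].  For a counterclockwise polygon the signs
   say that [l], travelled with its gradient on the left, leaves through it. *)
Definition bounce (V : nat -> pt) (l l' : leg) : Prop :=
  let A := V (lside l) in let B := V (S (lside l)) in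
  leval l A < 0 /\ 0 < leval l B /\ leval l' A = - leval l A /\
  lgrad l' = pscale (-1) (reflect (psub B A) (lgrad l)).

(** A closed path is [bounces V l ls l]; it has [length ls + 1] bounces. *)
Fixpoint bounces (V : nat -> pt) (l : leg) (ls : list leg) (l' : leg) : Prop :=
  match ls with
  | nil => bounce V l l'
  | m :: ms => bounce V l m /\ bounces V m ms l'
  end.

Definition side_height (V : nat -> pt) (i : nat) (z : pt) : R :=
  cross (psub (V (S i)) (V i)) (psub z (V i)).

Definition convex_quad (V : nat -> pt) : Prop :=
  (forall i, V (i + 4)%nat = V i) /\
  (forall i, 0 < side_height V i (V (i + 2)%nat) /\
             0 < side_height V i (V (i + 3)%nat)).

Definition crossing (V : nat -> pt) (l : leg) : pt :=
  let A := V (lside l) in let B := V (S (lside l)) in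
  lerp A B (leval l A / (leval l A - leval l B)).

Lemma leval_lerp (l : leg) (x y : pt) (t : R) :
  leval l (lerp x y t) = (1 - t) * leval l x + t * leval l y.
Proof.
  unfold leval, lerp, padd, pscale, pdot; simpl; ring.
Qed.

Lemma side_height_lerp (V : nat -> pt) (i : nat) (x y : pt) (t : R) :
  side_height V i (lerp x y t) =
  (1 - t) * side_height V i x + t * side_height V i y.
Proof.
  unfold side_height, cross, lerp, psub, padd, pscale; simpl; ring.
Qed.

Lemma side_height_start (V : nat -> pt) (i : nat) : side_height V i (V i) = 0.
Proof. unfold side_height, cross, psub; simpl; ring. Qed.

Lemma side_height_end (V : nat -> pt) (i : nat) : side_height V i (V (S i)) = 0.
Proof. unfold side_height, cross, psub; simpl; ring. Qed.

Lemma periodic4_mod (T : Type) (f : nat -> T) :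
  (forall i, f (i + 4)%nat = f i) -> forall i, f i = f (i mod 4)%nat.
Proof.
  intros Hf i.
  rewrite (Nat.div_mod_eq i 4) at 1.
  generalize (i mod 4)%nat as r; intro r.
  induction (i / 4)%nat as [|k IH].
  - reflexivity.
  - rewrite <- IH, <- (Hf (4 * k + r)%nat). f_equal. lia.
Qed.

Lemma crossing_param (V : nat -> pt) (l l' : leg) :
  bounce V l l' ->
  let u := leval l (V (lside l)) / (leval l (V (lside l)) - leval l (V (S (lside l)))) in
  0 < u < 1.
Proof.
  intros (HA & HB & _ & _) u; subst u.
  set (p := leval l _) in *; set (q := leval l (V (S _))) in *.
  split.
  - replace (p / (p - q)) with ((- p) / (q - p)) by (field; lra).
    apply Rdiv_lt_0_compat; lra.
  - replace (p / (p - q)) with ((- p) / (q - p)) by (field; lra).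
    apply Rmult_lt_reg_r with (q - p); [lra|].
    unfold Rdiv; rewrite Rmult_assoc, Rinv_l by lra; lra.
Qed.

Lemma leval_crossing (V : nat -> pt) (l l' : leg) :
  bounce V l l' -> leval l (crossing V l) = 0.
Proof.
  intros (HA & HB & _ & _); unfold crossing; rewrite leval_lerp; field; lra.
Qed.

(** [bounce] prescribes the new value only at the start of the side. The reflection fixes the side
    line pointwise, so the gradient rule forces the value at the other end. *)
Lemma bounce_end (V : nat -> pt) (l l' : leg) :
  bounce V l l' -> leval l' (V (S (lside l))) = - leval l (V (S (lside l))).
Proof.
  intros (HA & HB & H1 & H2).
  assert (HAB : leval l (V (S (lside l))) - leval l (V (lside l)) <> 0) by lra.
  revert H1 HAB. unfold leval. rewrite H2.
  destruct l as [s [g1 g2] m], l' as [s' g' m']; simpl.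
  destruct (V s) as [a1 a2], (V (S s)) as [b1 b2].
  unfold reflect, pscale, psub, pdot. cbn [fst snd]. intros H1 HAB.
  assert (He : (b1 - a1) * (b1 - a1) + (b2 - a2) * (b2 - a2) <> 0).
  { intro E.
    destruct (Rplus_sqr_eq_0 _ _ E) as [Z1 Z2].
    apply HAB. assert (E1 : b1 = a1) by lra. assert (E2 : b2 = a2) by lra.
    rewrite E1, E2. ring. }
  apply Rminus_diag_uniq. apply Rminus_diag_eq in H1. rewrite <- H1.
  field; exact He.
Qed.

Lemma leval_next_crossing (V : nat -> pt) (l l' : leg) :
  bounce V l l' -> leval l' (crossing V l) = 0.
Proof.
  intros H. pose proof (bounce_end _ _ _ H) as HB. destruct H as (H1 & H2 & H3 & _).
  unfold crossing; rewrite leval_lerp, H3, HB; field; lra.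
Qed.

(** At most one end of side [s] lies on the line of side [j]; the other has positive height, and [u]
    is strictly inside. *)
Lemma side_height_other (V : nat -> pt) (s j : nat) (u : R) :
  convex_quad V -> (s < 4)%nat -> (j < 4)%nat -> s <> j -> 0 < u < 1 ->
  0 < side_height V j (lerp (V s) (V (S s)) u).
Proof.
  intros [Hp Hc] Hs Hj Hsj Hu.
  rewrite side_height_lerp.
  destruct (Hc j) as [H2 H3].
  pose proof (side_height_start V j) as H0. pose proof (side_height_end V j) as H1.
  rewrite (periodic4_mod _ V Hp (S s)).
  assert (E : forall k, V k = V (k mod 4)%nat) by (apply periodic4_mod; exact Hp).
  rewrite (E (j + 2)%nat) in H2. rewrite (E (j + 3)%nat) in H3.
  rewrite (E (S j)) in H1.
  destruct s as [|[|[|[|s]]]]; destruct j as [|[|[|[|j]]]]; try lia; simpl in *; try nra.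
Qed.

Lemma side_height_self (V : nat -> pt) (s : nat) (u : R) :
  side_height V s (lerp (V s) (V (S s)) u) = 0.
Proof. rewrite side_height_lerp, side_height_start, side_height_end; ring. Qed.

Lemma side_height_segment (V : nat -> pt) (s s' j : nat) (u u' t : R) :
  convex_quad V -> (s < 4)%nat -> (s' < 4)%nat -> (j < 4)%nat -> s <> s' ->
  0 < u < 1 -> 0 < u' < 1 -> 0 < t < 1 ->
  0 < side_height V j
        (lerp (lerp (V s) (V (S s)) u) (lerp (V s') (V (S s')) u') t).
Proof.
  intros Hc Hs Hs' Hj Hne Hu Hu' Ht.
  rewrite side_height_lerp.
  destruct (Nat.eq_dec s j) as [->|H1].
  - rewrite side_height_self.
    assert (H2 := side_height_other V s' j u' Hc Hs' Hj (not_eq_sym Hne) Hu').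
    nra.
  - assert (H3 := side_height_other V s j u Hc Hs Hj H1 Hu).
    destruct (Nat.eq_dec s' j) as [->|H2].
    + rewrite side_height_self. nra.
    + assert (H4 := side_height_other V s' j u' Hc Hs' Hj H2 Hu'). nra.
Qed.

Lemma pt_eq (x y : pt) : fst x = fst y -> snd x = snd y -> x = y.
Proof. destruct x, y; simpl; intros; subst; reflexivity. Qed.

Lemma in_open_tri_of_cross (A B C z : pt) :
  0 < cross (psub B A) (psub z A) -> 0 < cross (psub C B) (psub z B) ->
  0 < cross (psub A C) (psub z C) -> in_open_tri A B C z.
Proof.
  intros H1 H2 H3.
  set (s := cross (psub B A) (psub C A)).
  assert (Hs : s = cross (psub B A) (psub z A) + cross (psub C B) (psub z B)
                   + cross (psub A C) (psub z C))
    by (unfold s, cross, psub; simpl; ring).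
  assert (0 < s) by lra.
  exists (cross (psub C B) (psub z B) / s), (cross (psub A C) (psub z C) / s),
    (cross (psub B A) (psub z A) / s).
  repeat split; try (apply Rdiv_lt_0_compat; lra).
  - rewrite Hs. field. lra.
  - apply pt_eq; unfold s in *; unfold cross, psub, padd, pscale in *; simpl in *;
      field; lra.
Qed.

Lemma in_interior_of_heights (a b c d : R) (z : pt) :
  snd (vQ a b) < 0 ->
  (forall j, (j < 4)%nat -> 0 < side_height (vert a b c d) j z) ->
  in_interior a b c d z.
Proof.
  intros HQ H. unfold in_interior.
  pose proof (H 0%nat ltac:(lia)) as H0. pose proof (H 1%nat ltac:(lia)) as H1.
  pose proof (H 2%nat ltac:(lia)) as H2. pose proof (H 3%nat ltac:(lia)) as H3.
  unfold side_height, vert in H0, H1, H2, H3.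
  change (1 mod 4)%nat with 1%nat in *. change (2 mod 4)%nat with 2%nat in *.
  change (0 mod 4)%nat with 0%nat in *. change (3 mod 4)%nat with 3%nat in *.
  change (4 mod 4)%nat with 0%nat in *. cbv iota in *.
  destruct (Rtotal_order (snd z) 0) as [Hz|[Hz|Hz]].
  - left. apply in_open_tri_of_cross; try assumption.
    unfold cross, psub, vP, vR; simpl. lra.
  - right; right. exists (fst z).
    revert H0 H1. unfold cross, psub, vP, vR; simpl. rewrite Hz. intros H0 H1.
    split; [split; nra|].
    unfold lerp, padd, pscale, vP, vR. apply pt_eq; simpl; [ring|rewrite Hz; ring].
  - right; left. apply in_open_tri_of_cross; try assumption.
    unfold cross, psub, vP, vR; simpl. lra.
Qed.

Lemma cross_perp (e g w : pt) :
  pdot g w = 0 -> cross e w * pdot g g = pdot e g * cross g w.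
Proof.
  intro H. apply Rminus_diag_uniq.
  transitivity (- cross g e * pdot g w); [unfold cross, pdot; ring | rewrite H; ring].
Qed.

Definition rot (g : pt) : pt := (snd g, - fst g).

(* [rot g] is the direction of travel along a leg with gradient [g]. *)
Lemma crossing_sub (V : nat -> pt) (l l' l'' : leg) :
  convex_quad V -> bounce V l l' -> bounce V l' l'' ->
  (lside l mod 4 <> lside l' mod 4)%nat /\
  exists t, 0 < t /\ psub (crossing V l') (crossing V l) = pscale t (rot (lgrad l')).
Proof.
  intros Hc H1 H2.
  pose proof (crossing_param _ _ _ H1) as Hu.
  pose proof (crossing_param _ _ _ H2) as Hu'.
  pose proof (leval_next_crossing _ _ _ H1) as Z1.
  pose proof (leval_crossing _ _ _ H2) as Z2.
  pose proof (bounce_end _ _ _ H1) as E1.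
  destruct H1 as (A1 & B1 & A2 & _). destruct H2 as (A3 & B3 & _ & _).
  assert (P4 : forall i, V i = V (i mod 4)%nat) by (apply periodic4_mod, Hc).
  assert (P4' : forall i, V (S i) = V (S (i mod 4))).
  { intro i. rewrite (P4 (S i)), (P4 (S (i mod 4))).
    f_equal. rewrite <- Nat.add_1_r, <- (Nat.add_1_r (i mod 4)).
    rewrite Nat.Div0.add_mod_idemp_l. reflexivity. }
  assert (Hne : (lside l mod 4 <> lside l' mod 4)%nat).
  { intro E. rewrite (P4 (lside l')), <- E, <- P4 in A3. lra. }
  split; [exact Hne|].
  set (g := lgrad l') in *. set (w := psub (crossing V l') (crossing V l)).
  assert (Hgw : pdot g w = 0).
  { replace (pdot g w) with (leval l' (crossing V l') - leval l' (crossing V l)).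
    - lra.
    - unfold leval, w, g, pdot, psub; simpl; ring. }
  (* As [w] is orthogonal to [g], only its sign along [rot g] is open. Two facts decide it through
     [cross_perp]: [l'] decreases along the side just left, and [w] points into the
     quadrilateral. *)
  set (e := psub (V (S (lside l))) (V (lside l))).
  assert (Heg : pdot e g < 0).
  { replace (pdot e g) with (leval l' (V (S (lside l))) - leval l' (V (lside l))).
    - lra.
    - unfold leval, e, g, pdot, psub; simpl; ring. }
  assert (Hew : 0 < cross e w).
  { assert (Hh : 0 < side_height V (lside l mod 4) (crossing V l')).
    { unfold crossing. rewrite (P4 (lside l')), (P4' (lside l')).
      rewrite (P4 (lside l')), (P4' (lside l')) in Hu'.
      apply side_height_other; auto; apply Nat.mod_upper_bound; lia. }
    assert (Hz : side_height V (lside l mod 4) (crossing V l) = 0).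
    { unfold crossing. rewrite (P4 (lside l)), (P4' (lside l)). apply side_height_self. }
    unfold side_height in Hh, Hz. rewrite <- P4, <- P4' in Hh, Hz.
    replace (cross e w) with
      (cross (psub (V (S (lside l))) (V (lside l))) (psub (crossing V l') (V (lside l))) -
       cross (psub (V (S (lside l))) (V (lside l))) (psub (crossing V l) (V (lside l)))).
    - lra.
    - unfold e, w, cross, psub; simpl; ring. }
  assert (Hgg : 0 < pdot g g).
  { assert (Hsq : 0 <= pdot g g) by (unfold pdot; nra).
    destruct Hsq as [Hsq|Hsq]; [exact Hsq|exfalso].
    destruct (Rplus_sqr_eq_0 (fst g) (snd g) (eq_sym Hsq)) as [G1 G2].
    unfold pdot in Heg. rewrite G1, G2 in Heg. lra. }
  exists (- cross g w / pdot g g). split.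
  - pose proof (cross_perp e g w Hgw) as Hx.
    apply Rdiv_lt_0_compat; [|exact Hgg].
    assert (0 < cross e w * pdot g g) by (apply Rmult_lt_0_compat; assumption).
    nra.
  - clearbody w g. clear -Hgw Hgg. unfold rot, pscale, cross, pdot in *.
    apply pt_eq; simpl.
    + apply Rmult_eq_reg_r with (fst g * fst g + snd g * snd g); [|lra].
      transitivity (- (fst g * snd w - snd g * fst w) * snd g); [|field; lra].
      apply Rminus_diag_uniq. transitivity (fst g * (fst g * fst w + snd g * snd w));
        [ring | rewrite Hgw; ring].
    + apply Rmult_eq_reg_r with (fst g * fst g + snd g * snd g); [|lra].
      transitivity (- (fst g * snd w - snd g * fst w) * - fst g); [|field; lra].
      apply Rminus_diag_uniq. transitivity (snd g * (fst g * fst w + snd g * snd w));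
        [ring | rewrite Hgw; ring].
Qed.

(** A reflection reverses orientation, so it commutes with a quarter turn only up to sign; this
    accounts for the minus sign in [bounce]. *)
Lemma rot_reflect (e g : pt) (t : R) : pdot e e <> 0 ->
  pscale t (rot (pscale (-1) (reflect e g))) = reflect e (pscale t (rot g)).
Proof.
  intro H.
  unfold reflect, rot, pscale, psub, pdot in *; apply pt_eq; simpl; field; exact H.
Qed.

Lemma reflect_scale (e v : pt) (t : R) :
  reflect e (pscale t v) = pscale t (reflect e v).
Proof.
  unfold reflect, pscale, psub, pdot, Rdiv; apply pt_eq; simpl; ring.
Qed.

Lemma reflect_opp (e v : pt) : reflect (pscale (-1) e) v = reflect e v.
Proof.
  unfold reflect. replace (pdot (pscale (-1) e) (pscale (-1) e)) with (pdot e e)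
    by (unfold pdot, pscale; simpl; ring).
  unfold pscale, psub, pdot, Rdiv; apply pt_eq; simpl; ring.
Qed.

(** * From closed chains of legs to finitely many words *)

Fixpoint words (k : nat) : list (list nat) :=
  match k with
  | O => nil :: nil
  | S k => nil :: flat_map (fun w => map (fun j => j :: w) (seq 0 4)) (words k)
  end.

Lemma in_words (k : nat) (w : list nat) :
  (length w <= k)%nat -> (forall j, In j w -> (j < 4)%nat) -> In w (words k).
Proof.
  revert w. induction k as [|k IH]; intros [|j w] Hl Hw; simpl in Hl; try lia.
  - left; reflexivity.
  - left; reflexivity.
  - right. apply in_flat_map. exists w. split.
    + apply IH; [lia|]. intros i Hi. apply Hw. right; exact Hi.
    + apply in_map_iff. exists j. split; [reflexivity|].
      apply in_seq. specialize (Hw j (or_introl eq_refl)). lia.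
Qed.

Lemma convex_vert (a b c d : R) : convex_quad (vert a b c d) -> snd (vQ a b) < 0.
Proof.
  intros [_ H]. destruct (H 0%nat) as [H1 _].
  unfold side_height, cross, psub, vert, vP, vR in H1. simpl in H1.
  unfold vQ, pscale in *; simpl in *. lra.
Qed.

Lemma bounces_nth (V : nat -> pt) (e : leg) (ls : list leg) (l : leg) (i : nat) :
  bounces V l ls e -> (i <= length ls)%nat ->
  bounce V (nth i (l :: ls) e) (nth (S i) (l :: ls) e).
Proof.
  revert l i. induction ls as [|m ms IH]; intros l i H Hi; simpl in Hi.
  - replace i with 0%nat by lia. exact H.
  - destruct H as [H1 H2]. destruct i as [|i]; [exact H1|].
    apply (IH m i H2). lia.
Qed.

(** A billiard path is defined with the least period of its positions, whereas a closed chain of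
    legs need not be primitive. *)
Lemma minimal_period (T : Type) (x : nat -> T) (N : nat) :
  (0 < N)%nat -> (forall i, x (i + N)%nat = x i) ->
  exists n, (0 < n <= N)%nat /\ (forall i, x (i + n)%nat = x i) /\
    (forall k, (0 < k < n)%nat -> exists i, x (i + k)%nat <> x i).
Proof.
  induction N as [N IH] using (well_founded_induction lt_wf). intros HN Hx.
  destruct (classic (exists k, (0 < k < N)%nat /\ forall i, x (i + k)%nat = x i))
    as [[k [Hk Hxk]]|Hno].
  - destruct (IH k) as [n [H1 H2]]; try lia; auto.
    exists n. split; [lia|exact H2].
  - exists N. split; [lia|]. split; [exact Hx|].
    intros k Hk. apply not_all_ex_not. intro H. apply Hno. exists k; auto.
Qed.

(** The sign conditions on the legs put every crossing strictly inside its side, and convexity keeps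
    the segments between them in the interior. The factor 2 allows for squaring words of odd
    length. *)
Lemma tile_of_bounces (a b c d : R) (l : leg) (ls : list leg) (M : nat) :
  inQ a b c d -> convex_quad (vert a b c d) -> bounces (vert a b c d) l ls l ->
  (length ls < M)%nat -> exists w, In w (words (2 * M)) /\ in_orbit_tile w a b c d.
Proof.
  intros HQ Hc Hb HM. set (V := vert a b c d) in *. set (N := S (length ls)).
  set (f := fun i => nth (i mod N) (l :: ls) l).
  assert (Hf : forall i, bounce V (f i) (f (S i))).
  { intro i. unfold f.
    assert (Hi : (i mod N < N)%nat) by (apply Nat.mod_upper_bound; unfold N; lia).
    replace (nth (S i mod N) (l :: ls) l) with (nth (S (i mod N)) (l :: ls) l).
    - apply bounces_nth; [exact Hb|]. change (i mod N < S (length ls))%nat in Hi. lia.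
    - rewrite <- Nat.add_1_r, <- (Nat.add_1_r i), <- Nat.Div0.add_mod_idemp_l.
      destruct (Nat.eq_dec (i mod N + 1) N) as [E|E].
      + rewrite E, Nat.Div0.mod_same. rewrite nth_overflow; [reflexivity|simpl; unfold N; lia].
      + rewrite (Nat.mod_small (i mod N + 1)); [reflexivity|lia]. }
  assert (HfN : forall i, f (i + N)%nat = f i).
  { intro i. unfold f. rewrite <- Nat.Div0.add_mod_idemp_r, Nat.Div0.mod_same, Nat.add_0_r.
    reflexivity. }
  (* Legs may carry side indices beyond 3, hence the reduction modulo 4. *)
  set (x := fun i => crossing V (f i)). set (s := fun i => (lside (f i) mod 4)%nat).
  assert (P4 : forall i, V i = V (i mod 4)%nat) by (apply periodic4_mod, Hc).
  assert (P4' : forall i, V (S i) = V (S (i mod 4))).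
  { intro i. rewrite (P4 (S i)), (P4 (S (i mod 4))).
    f_equal. rewrite <- Nat.add_1_r, <- (Nat.add_1_r (i mod 4)).
    rewrite Nat.Div0.add_mod_idemp_l. reflexivity. }
  assert (Hs : forall i, (s i < 4)%nat) by (intro i; apply Nat.mod_upper_bound; lia).
  assert (Hon : forall i, exists u, 0 < u < 1 /\ x i = lerp (V (s i)) (V (S (s i))) u).
  { intro i. eexists. split; [apply (crossing_param _ _ _ (Hf i))|].
    unfold x, s, crossing. rewrite <- P4, <- P4'. reflexivity. }
  (* A position determines its side, so a period of the positions is a period of the sides. *)
  assert (Hsx : forall i j, x i = x j -> s i = s j).
  { intros i j E. destruct (Nat.eq_dec (s i) (s j)) as [|Hne]; [assumption|exfalso].
    destruct (Hon i) as [u [Hu Eu]]. destruct (Hon j) as [u' [Hu' Eu']].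
    assert (H1 := side_height_other V (s i) (s j) u Hc (Hs i) (Hs j) Hne Hu).
    rewrite <- Eu, E, Eu', side_height_self in H1. lra. }
  assert (Hdir : forall i, s i <> s (S i) /\ exists t, 0 < t /\
      psub (x (S i)) (x i) = pscale t (rot (lgrad (f (S i))))).
  { intro i. apply (crossing_sub V (f i) (f (S i)) (f (S (S i)))); auto. }
  destruct (minimal_period _ x N) as [n [Hn [Hper Hmin]]].
  { unfold N; lia. }
  { intro i. unfold x. rewrite HfN. reflexivity. }
  exists (orbit_word n s). split.
  - apply in_words.
    + unfold orbit_word. rewrite length_map, length_seq.
      unfold N in Hn. destruct (Nat.even n); lia.
    + intros j Hj. unfold orbit_word in Hj. apply in_map_iff in Hj.
      destruct Hj as [k [<- _]]. apply Hs.
  - split; [exact HQ|]. exists n, s, x. split; [|reflexivity].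
    split; [lia|]. split; [|split; [|split; [|split]]].
    + intro i. split; [apply Hsx|]; apply Hper.
    + intro i. split; [apply Hs|]. fold V. apply Hon.
    + intros i t Ht. apply in_interior_of_heights; [apply (convex_vert a b c d); exact Hc|].
      intros j Hj. destruct (Hdir i) as [Hne _].
      destruct (Hon i) as [u [Hu ->]]. destruct (Hon (S i)) as [u' [Hu' ->]].
      apply side_height_segment; auto.
    + intro i. destruct (Hdir i) as [_ [t [Ht Et]]]. destruct (Hdir (S i)) as [_ [t' [Ht' Et']]].
      exists (t' / t). split; [apply Rdiv_lt_0_compat; assumption|].
      rewrite Et, Et'. destruct (Hf (S i)) as (HA & HB & _ & Hg).
      rewrite Hg. unfold side_dir. fold V. unfold s. rewrite <- P4, <- P4'.
      set (e := psub (V (S (lside (f (S i))))) (V (lside (f (S i))))) in *.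
      rewrite <- rot_reflect.
      * generalize (rot (pscale (-1) (reflect e (lgrad (f (S i)))))) as r; intro r.
        unfold pscale; apply pt_eq; simpl; field; apply Rgt_not_eq; assumption.
      * intro E. destruct (Rplus_sqr_eq_0 (fst e) (snd e) E) as [G1 G2].
        unfold e, psub in G1, G2; simpl in G1, G2.
        unfold leval, pdot in HA, HB.
        assert (Hx1 : fst (V (S (lside (f (S i))))) = fst (V (lside (f (S i))))) by lra.
        assert (Hx2 : snd (V (S (lside (f (S i))))) = snd (V (lside (f (S i))))) by lra.
        rewrite Hx1, Hx2 in HB. lra.
    + exact Hmin.
Qed.

(** * Paths along a side *)

Definition dirv (t : R) : pt := (cos t, sin t).

Lemma pdot_dirv (s t : R) : pdot (dirv s) (dirv t) = cos (s - t).
Proof. unfold pdot, dirv; simpl. rewrite cos_minus. ring. Qed.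

Lemma dirv_add_PI (t : R) : dirv (t + PI) = pscale (-1) (dirv t).
Proof. unfold dirv, pscale; simpl. rewrite neg_cos, neg_sin. apply pt_eq; simpl; ring. Qed.

Lemma dirv_add_2PI (t : R) : dirv (t + 2 * PI) = dirv t.
Proof.
  replace (t + 2 * PI) with (t + PI + PI) by ring.
  rewrite !dirv_add_PI. unfold pscale, dirv; apply pt_eq; simpl; ring.
Qed.

Lemma reflect_dirv (k s t : R) : k <> 0 ->
  reflect (pscale k (dirv s)) (dirv t) = dirv (2 * s - t).
Proof.
  intro Hk.
  assert (H1 : pdot (dirv s) (dirv s) = 1) by (rewrite pdot_dirv, Rminus_diag; apply cos_0).
  unfold reflect.
  replace (pdot (dirv t) (pscale k (dirv s))) with (k * pdot (dirv t) (dirv s))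
    by (unfold pdot, pscale; simpl; ring).
  replace (pdot (pscale k (dirv s)) (pscale k (dirv s))) with (k * k)
    by (transitivity (k * k * pdot (dirv s) (dirv s));
        [rewrite H1; ring | unfold pdot, pscale; simpl; ring]).
  replace (2 * (k * pdot (dirv t) (dirv s)) / (k * k))
    with (2 * pdot (dirv s) (dirv t) / k)
    by (replace (pdot (dirv t) (dirv s)) with (pdot (dirv s) (dirv t))
          by (unfold pdot; ring); field; exact Hk).
  replace (2 * s - t) with (s + (s - t)) by ring.
  replace (dirv (s + (s - t))) with
    (cos s * (cos s * cos t + sin s * sin t) - sin s * (sin s * cos t - cos s * sin t),
     sin s * (cos s * cos t + sin s * sin t) + cos s * (sin s * cos t - cos s * sin t))
    by (unfold dirv; rewrite cos_plus, sin_plus, cos_minus, sin_minus; reflexivity).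
  revert H1. unfold pdot, pscale, psub, dirv; simpl. intro H1.
  apply pt_eq; simpl.
  - transitivity (2 * (cos s * cos t + sin s * sin t) * cos s
      - cos t * (cos s * cos s + sin s * sin s)); [rewrite H1; field; exact Hk | ring].
  - transitivity (2 * (cos s * cos t + sin s * sin t) * sin s
      - sin t * (cos s * cos s + sin s * sin s)); [rewrite H1; field; exact Hk | ring].
Qed.

(* [o = 1] or [o = -1] is the orientation of the frame. *)
Definition ray (o w t : R) : pt := dirv (w + o * t).

Definition polar (O : pt) (o w r t : R) : pt := padd O (pscale r (ray o w t)).

(** Side indices run counterclockwise, so a mirrored frame lists the ends of each side in the
    opposite order. *)
Definition ends (V : nat -> pt) (o : R) (s : nat) (X Y : pt) : Prop :=
  (o = 1 /\ V s = X /\ V (S s) = Y) \/ (o = -1 /\ V s = Y /\ V (S s) = X).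

(* The leg on the line at distance [d] from [O] whose normal has angle [phi].
   The sign [sg] is [1] when the leg is travelled in the direction of
   decreasing angle. *)
Definition wleg (O : pt) (o w : R) (s : nat) (sg phi d : R) : leg :=
  Leg s (pscale (o * sg) (ray o w phi)) (o * sg * (d + pdot O (ray o w phi))).

Lemma leval_wleg (O : pt) (o w : R) (s : nat) (sg phi d r t : R) :
  o = 1 \/ o = -1 ->
  leval (wleg O o w s sg phi d) (polar O o w r t) = o * (sg * (r * cos (t - phi) - d)).
Proof.
  intro Ho.
  assert (E : cos (t - phi) = pdot (ray o w t) (ray o w phi)).
  { unfold ray. rewrite pdot_dirv. destruct Ho as [->| ->].
    - f_equal; ring.
    - rewrite <- cos_neg. f_equal; ring. }
  rewrite E. unfold leval, wleg, polar, padd, pscale, pdot; simpl. ring.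
Qed.

(** Passing to [o = -1] swaps the ends of the side and negates all values, so the same inequalities
    serve both orientations. *)
Lemma bounce_wleg (V : nat -> pt) (O : pt) (o w : R) (s s' : nat)
    (sg phi d sg' phi' d' rX tX rY tY k al : R) :
  ends V o s (polar O o w rX tX) (polar O o w rY tY) ->
  psub (polar O o w rY tY) (polar O o w rX tX) = pscale k (ray o w al) -> k <> 0 ->
  sg * (rX * cos (tX - phi) - d) < 0 -> 0 < sg * (rY * cos (tY - phi) - d) ->
  sg' * (rX * cos (tX - phi') - d') = - (sg * (rX * cos (tX - phi) - d)) ->
  sg' * (rY * cos (tY - phi') - d') = - (sg * (rY * cos (tY - phi) - d)) ->
  pscale sg' (ray o w phi') = pscale (- sg) (ray o w (2 * al - phi)) ->
  bounce V (wleg O o w s sg phi d) (wleg O o w s' sg' phi' d').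
Proof.
  intros He Hk Hk0 H1 H2 H3 H4 Hg.
  assert (Hr : forall e, e = pscale k (ray o w al) \/ e = pscale (-1) (pscale k (ray o w al)) ->
    o * o = 1 ->
    pscale (o * sg') (ray o w phi') =
    pscale (-1) (reflect e (pscale (o * sg) (ray o w phi)))).
  { intros e Hek Hoo. rewrite reflect_scale.
    assert (E : reflect e (ray o w phi) = ray o w (2 * al - phi)).
    { replace (reflect e (ray o w phi)) with (reflect (pscale k (ray o w al)) (ray o w phi)).
      - unfold ray. rewrite reflect_dirv by exact Hk0. f_equal; ring.
      - destruct Hek as [->| ->]; [reflexivity|]. rewrite reflect_opp. reflexivity. }
    rewrite E.
    replace (pscale (o * sg') (ray o w phi')) with (pscale o (pscale sg' (ray o w phi')))
      by (unfold pscale; apply pt_eq; simpl; ring).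
    rewrite Hg. unfold pscale; apply pt_eq; simpl; ring. }
  unfold bounce. change (lside (wleg O o w s sg phi d)) with s.
  change (lgrad (wleg O o w s sg phi d)) with (pscale (o * sg) (ray o w phi)).
  change (lgrad (wleg O o w s' sg' phi' d')) with (pscale (o * sg') (ray o w phi')).
  destruct He as [(Ho & -> & ->)|(Ho & -> & ->)];
    rewrite !leval_wleg by (rewrite Ho; auto).
  - split; [rewrite Ho; lra|]. split; [rewrite Ho; lra|]. split; [rewrite Ho; lra|].
    apply Hr; [left; exact Hk | rewrite Ho; ring].
  - split; [rewrite Ho; lra|]. split; [rewrite Ho; lra|]. split; [rewrite Ho; lra|].
    apply Hr; [right | rewrite Ho; ring].
    rewrite <- Hk. unfold psub, pscale; apply pt_eq; simpl; ring.
Qed.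

(* Polar coordinates about the point [wO] where the lines of two opposite sides
   (the walls) meet.  The third side (the floor) joins [(rP, 0)] to [(rQ, tau)]
   and makes interior angles [PI / 2 - (tau + dev)] and [PI / 2 + dev] with the
   walls [sp] and [sq]; the walls end at [(rS, 0)] and [(rT, tau)]. *)
Record wedge (V : nat -> pt) := Wedge {
  wO : pt; wo : R; ww : R; tau : R; dev : R; len : R;
  rP : R; rQ : R; rS : R; rT : R;
  sp : nat; sq : nat; sf : nat;
  wedge_p : ends V wo sp (polar wO wo ww rS 0) (polar wO wo ww rP 0);
  wedge_q : ends V wo sq (polar wO wo ww rQ tau) (polar wO wo ww rT tau);
  wedge_f : ends V wo sf (polar wO wo ww rP 0) (polar wO wo ww rQ tau);
  wedge_floor : psub (polar wO wo ww rQ tau) (polar wO wo ww rP 0) =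
                pscale len (ray wo ww (tau + dev + PI / 2));
  len_pos : 0 < len;
  tau_pos : 0 < tau;
  tau_small : tau <= 1 / 10;
  dev_small : - tau <= dev <= tau;
  rP_pos : 0 < rP;
  rQ_pos : 0 < rQ;
  floor_height : rP * cos (tau + dev) = rQ * cos dev;
  far_S : 0 < rS < rP * cos (6 * tau);
  far_T : 0 < rT < rP * cos (6 * tau);
  far_T' : rT < rQ
}.

Lemma cos_le_abs (x y : R) : - y <= x <= y -> y <= PI -> cos y <= cos x.
Proof.
  intros Hx Hy. destruct (Rle_dec 0 x) as [H|H].
  - destruct (Req_dec x y) as [->|Hne]; [lra|]. left. apply cos_decreasing_1; lra.
  - rewrite <- (cos_neg x). destruct (Req_dec (- x) y) as [->|Hne]; [lra|].
    left. apply cos_decreasing_1; lra.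
Qed.

Lemma cos_lt_abs (x y : R) : - y < x < y -> y <= PI -> cos y < cos x.
Proof.
  intros Hx Hy. destruct (Rle_dec 0 x) as [H|H].
  - apply cos_decreasing_1; lra.
  - rewrite <- (cos_neg x). apply cos_decreasing_1; lra.
Qed.

Lemma cos_pm (x y : R) : y = x \/ y = - x -> cos y = cos x.
Proof. intros [->| ->]; [reflexivity|apply cos_neg]. Qed.

Lemma between_four (a1 a2 b1 b2 : R) : a1 < b1 -> a1 < b2 -> a2 < b1 -> a2 < b2 ->
  exists x, a1 < x /\ a2 < x /\ x < b1 /\ x < b2.
Proof.
  intros. exists ((Rmax a1 a2 + Rmin b1 b2) / 2).
  assert (Rmax a1 a2 < Rmin b1 b2) by (apply Rmax_lub_lt; apply Rmin_glb_lt; assumption).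
  pose proof (Rmax_l a1 a2). pose proof (Rmax_r a1 a2).
  pose proof (Rmin_l b1 b2). pose proof (Rmin_r b1 b2). lra.
Qed.

Definition wl {V : nat -> pt} (W : wedge V) (s : nat) (sg phi d : R) : leg :=
  wleg (wO V W) (wo V W) (ww V W) s sg phi d.

Arguments tau {V}. Arguments dev {V}. Arguments rP {V}. Arguments rQ {V}.
Arguments rS {V}. Arguments rT {V}. Arguments sp {V}. Arguments sq {V}. Arguments sf {V}.

Lemma far_lt (r x m d : R) : 0 < r < m -> m < d -> r * cos x - d < 0.
Proof. intros. pose proof (COS_bound x). nra. Qed.

(** The wall passes through the apex, so the reflection keeps [d]. The number [y] bounds the
    inclination of the leg, so that one inequality on [d] can serve several bounces. The lower bound
    on [d] puts the far end of the wall on the apex side of the leg. *)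
Lemma bounce_q (V : nat -> pt) (W : wedge V) (s : nat) (phi phi' d y : R) :
  d < rQ W * cos y -> rP W * cos (6 * tau W) < d ->
  - y <= tau W - phi <= y -> y <= PI -> phi' = 2 * tau W - phi ->
  bounce V (wl W (sq W) (-1) phi d) (wl W s 1 phi' d).
Proof.
  intros H1 H2 H3 H4 ->.
  pose proof (far_T V W). pose proof (far_T' V W). pose proof (rQ_pos V W).
  assert (E : cos (tau W - (2 * tau W - phi)) = cos (tau W - phi))
    by (apply cos_pm; right; ring).
  apply bounce_wleg with (rX := rQ W) (tX := tau W) (rY := rT W) (tY := tau W)
    (k := rT W - rQ W) (al := tau W).
  - apply wedge_q.
  - unfold polar, padd, psub, pscale; apply pt_eq; simpl; ring.
  - lra.
  - pose proof (cos_le_abs _ _ H3 H4). nra.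
  - pose proof (far_lt (rT W) (tau W - phi) _ d (far_T V W) H2). lra.
  - rewrite E. ring.
  - rewrite E. ring.
  - unfold pscale; apply pt_eq; simpl; ring.
Qed.

Lemma bounce_p (V : nat -> pt) (W : wedge V) (s : nat) (phi phi' d y : R) :
  d < rP W * cos y -> rP W * cos (6 * tau W) < d ->
  - y <= phi <= y -> y <= PI -> phi' = - phi ->
  bounce V (wl W (sp W) 1 phi d) (wl W s (-1) phi' d).
Proof.
  intros H1 H2 H3 H4 ->.
  pose proof (far_S V W). pose proof (rP_pos V W).
  assert (E : cos (0 - phi) = cos phi) by (apply cos_pm; right; ring).
  assert (E' : cos (0 - - phi) = cos phi) by (apply cos_pm; left; ring).
  pose proof (COS_bound (6 * tau W)).
  apply bounce_wleg with (rX := rS W) (tX := 0) (rY := rP W) (tY := 0)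
    (k := rP W - rS W) (al := 0).
  - apply wedge_p.
  - unfold polar, padd, psub, pscale; apply pt_eq; simpl; ring.
  - nra.
  - pose proof (far_lt (rS W) (0 - phi) _ d (far_S V W) H2). lra.
  - rewrite E. pose proof (cos_le_abs _ _ H3 H4). nra.
  - rewrite E, E'. ring.
  - rewrite E, E'. ring.
  - replace (2 * 0 - phi) with (- phi) by ring. reflexivity.
Qed.

(** Both sides equal [2 h cos (phi - tau - dev)], where [h] is the distance from the apex to the
    floor line. This is the sum of the distances of a leg and its mirror image in the floor, so a
    bound on one of them at a floor vertex is the reverse bound on the other. *)
Lemma floor_sum (V : nat -> pt) (W : wedge V) (phi phi' : R) :
  phi' = 2 * (tau W + dev W) - phi ->
  rP W * (cos phi + cos phi') = rQ W * (cos (tau W - phi) + cos (tau W - phi')).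
Proof.
  intros ->. set (n := tau W + dev W). set (x := phi - n).
  replace (cos phi) with (cos (n + x)) by (f_equal; unfold x; ring).
  replace (cos (2 * n - phi)) with (cos (n - x)) by (f_equal; unfold x; ring).
  replace (cos (tau W - phi)) with (cos (dev W + x))
    by (apply cos_pm; right; unfold x, n; ring).
  replace (cos (tau W - (2 * n - phi))) with (cos (dev W - x))
    by (apply cos_pm; right; unfold x, n; ring).
  rewrite !cos_plus, !cos_minus.
  pose proof (floor_height V W) as H. fold n in H.
  transitivity (2 * cos x * (rP W * cos n)); [ring|]. rewrite H. ring.
Qed.

(** Unlike a wall, the floor keeps the sense [sg] in which the path turns about the apex, and
    changes the distance. *)
Lemma bounce_f (V : nat -> pt) (W : wedge V) (s : nat) (sg phi phi' d d' : R) :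
  sg * (rP W * cos phi - d) < 0 -> 0 < sg * (rQ W * cos (tau W - phi) - d) ->
  phi' = 2 * (tau W + dev W) - phi -> d + d' = rP W * (cos phi + cos phi') ->
  bounce V (wl W (sf W) sg phi d) (wl W s sg phi' d').
Proof.
  intros H1 H2 Hp Hd. pose proof (floor_sum V W phi phi' Hp) as Hs.
  assert (E : forall x, cos (0 - x) = cos x) by (intro x; apply cos_pm; right; ring).
  apply bounce_wleg with (rX := rP W) (tX := 0) (rY := rQ W) (tY := tau W)
    (k := len V W) (al := tau W + dev W + PI / 2).
  - apply wedge_f.
  - apply wedge_floor.
  - pose proof (len_pos V W). lra.
  - rewrite E. exact H1.
  - exact H2.
  - rewrite !E. replace d' with (rP W * (cos phi + cos phi') - d) by lra. ring.
  - replace d' with (rQ W * (cos (tau W - phi) + cos (tau W - phi')) - d) by lra. ring.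
  - rewrite Hp.
    replace (ray (wo V W) (ww V W) (2 * (tau W + dev W + PI / 2) - phi)) with
      (pscale (-1) (ray (wo V W) (ww V W) (2 * (tau W + dev W) - phi))).
    + unfold pscale; apply pt_eq; simpl; ring.
    + unfold ray. rewrite <- dirv_add_PI.
      pose proof (wedge_f V W) as [[-> _]|[-> _]].
      * f_equal. field.
      * rewrite <- (dirv_add_2PI (ww V W + -1 * (2 * (tau W + dev W + PI / 2) - phi))).
        f_equal. field.
Qed.

Lemma bounce_f_out (V : nat -> pt) (W : wedge V) (s : nat) (phi phi' d d' y z : R) :
  rP W * cos y < d -> d < rQ W * cos z -> y = phi \/ y = - phi ->
  z = tau W - phi \/ z = - (tau W - phi) ->
  phi' = 2 * (tau W + dev W) - phi -> d + d' = rP W * (cos phi + cos phi') ->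
  bounce V (wl W (sf W) 1 phi d) (wl W s 1 phi' d').
Proof.
  intros H1 H2 Hy Hz Hp Hd. rewrite (cos_pm _ _ Hy) in H1. rewrite (cos_pm _ _ Hz) in H2.
  apply bounce_f; auto; lra.
Qed.

Lemma bounce_f_in (V : nat -> pt) (W : wedge V) (s : nat) (phi phi' d d' y z : R) :
  d < rP W * cos y -> rQ W * cos z < d -> y = phi \/ y = - phi ->
  z = tau W - phi \/ z = - (tau W - phi) ->
  phi' = 2 * (tau W + dev W) - phi -> d + d' = rP W * (cos phi + cos phi') ->
  bounce V (wl W (sf W) (-1) phi d) (wl W s (-1) phi' d').
Proof.
  intros H1 H2 Hy Hz Hp Hd. rewrite (cos_pm _ _ Hy) in H1. rewrite (cos_pm _ _ Hz) in H2.
  apply bounce_f; auto; lra.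
Qed.

(** The inequality that justifies a bounce is found by backtracking over the hypotheses on the
    distance of the leg; [lra] checks the angles. *)
Ltac bounce_step :=
  match goal with
  | H : ?d < rQ _ * cos ?y, L : _ < ?d |- bounce _ (wl ?W (sq _) _ _ ?d) _ =>
      apply (bounce_q _ W _ _ _ d y H L); lra
  | H : ?d < rP _ * cos ?y, L : _ < ?d |- bounce _ (wl ?W (sp _) _ _ ?d) _ =>
      apply (bounce_p _ W _ _ _ d y H L); lra
  | H : rP _ * cos ?y < ?d, H' : ?d < rQ _ * cos ?z |- bounce _ (wl ?W (sf _) 1 _ ?d) _ =>
      apply (bounce_f_out _ W _ _ _ d _ y z H H'); lra
  | H : ?d < rP _ * cos ?y, H' : rQ _ * cos ?z < ?d |- bounce _ (wl ?W (sf _) (-1) _ ?d) _ =>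
      apply (bounce_f_in _ W _ _ _ d _ y z H H'); lra
  end.

Ltac closed_path := cbn [bounces]; repeat (split; [bounce_step|]); bounce_step.

Lemma PI_gt_2 : 2 < PI.
Proof. pose proof PI2_1. lra. Qed.

Lemma rP_smono (V : nat -> pt) (W : wedge V) (x y : R) :
  - y < x < y -> y <= PI -> rP W * cos y < rP W * cos x.
Proof.
  intros Hx Hy. pose proof (rP_pos V W). pose proof (cos_lt_abs _ _ Hx Hy).
  apply Rmult_lt_compat_l; lra.
Qed.

Lemma rQ_smono (V : nat -> pt) (W : wedge V) (x y : R) :
  - y < x < y -> y <= PI -> rQ W * cos y < rQ W * cos x.
Proof.
  intros Hx Hy. pose proof (rQ_pos V W). pose proof (cos_lt_abs _ _ Hx Hy).
  apply Rmult_lt_compat_l; lra.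
Qed.

(* With [rP * cos (tau + dev) = rQ * cos dev], comparing [rP * cos x] with
   [rQ * cos y] amounts to comparing two products of cosines. *)
Lemma rP_lt_rQ (V : nat -> pt) (W : wedge V) (x y : R) :
  cos (x + dev W) + cos (x - dev W) <
    cos (y + (tau W + dev W)) + cos (y - (tau W + dev W)) ->
  rP W * cos x < rQ W * cos y.
Proof.
  pose proof (rP_pos V W) as HP. pose proof (floor_height V W) as HF.
  set (n := tau W + dev W) in *.
  rewrite !cos_plus, !cos_minus. intro H.
  pose proof PI_gt_2. pose proof (tau_small V W). pose proof (dev_small V W) as Hd.
  assert (Hc : 0 < cos (dev W)) by (apply cos_gt_0; lra).
  apply Rmult_lt_reg_r with (cos (dev W)); [exact Hc|].
  rewrite (Rmult_assoc (rQ W)), (Rmult_comm (cos y)), <- (Rmult_assoc (rQ W)), <- HF.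
  rewrite !Rmult_assoc. apply Rmult_lt_compat_l; [exact HP|].
  nra.
Qed.

Lemma rQ_lt_rP (V : nat -> pt) (W : wedge V) (x y : R) :
  cos (y + (tau W + dev W)) + cos (y - (tau W + dev W)) <
    cos (x + dev W) + cos (x - dev W) ->
  rQ W * cos y < rP W * cos x.
Proof.
  pose proof (rP_pos V W) as HP. pose proof (floor_height V W) as HF.
  set (n := tau W + dev W) in *.
  rewrite !cos_plus, !cos_minus. intro H.
  pose proof PI_gt_2. pose proof (tau_small V W). pose proof (dev_small V W) as Hd.
  assert (Hc : 0 < cos (dev W)) by (apply cos_gt_0; lra).
  apply Rmult_lt_reg_r with (cos (dev W)); [exact Hc|].
  rewrite (Rmult_assoc (rQ W)), (Rmult_comm (cos y)), <- (Rmult_assoc (rQ W)), <- HF.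
  rewrite !Rmult_assoc. apply Rmult_lt_compat_l; [exact HP|].
  nra.
Qed.

(** * The six paths in a wedge *)

Definition has_short_path (V : nat -> pt) : Prop :=
  exists l ls, (length ls < 28)%nat /\ bounces V l ls l.

Ltac wedge_facts W :=
  pose proof PI_gt_2; pose proof (tau_pos _ W); pose proof (tau_small _ W);
  pose proof (dev_small _ W).

(** The Fagnano path is the orthic triangle. The apex, a vertex of the acute triangle, is an
    excentre of it, so all three legs have the same distance [d], the one that the floor bounce
    preserves. *)
Lemma path_acute (V : nat -> pt) (W : wedge V) :
  dev W < 0 -> 0 < tau W + dev W -> has_short_path V.
Proof.
  intros Hc Ht. wedge_facts W. set (t := tau W) in *. set (c := dev W) in *.
  pose proof (rP_pos V W) as HP. pose proof (rQ_pos V W) as HQ.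
  set (d := rP W * (cos (2 * t + c) + cos c) / 2).
  assert (A1 : rP W * cos (2 * t + c) < rP W * cos c) by (apply rP_smono; lra).
  assert (A2 : rP W * cos (2 * t + c) < d) by (unfold d; lra).
  assert (A3 : d < rP W * cos (- c)) by (rewrite cos_neg; unfold d; lra).
  assert (A4 : d < rQ W * cos (t + c)).
  { assert (Hd : d = rQ W * ((cos (t + c) + cos (t - c)) / 2)).
    { transitivity (rP W * cos (t + c) * cos t).
      - unfold d. replace (2 * t + c) with ((t + c) + t) by ring.
        replace (cos c) with (cos ((t + c) - t)) by (f_equal; ring).
        rewrite (cos_plus (t + c) t), (cos_minus (t + c) t). field.
      - pose proof (floor_height V W) as HF. fold t c in HF. rewrite HF.
        rewrite cos_plus, cos_minus. field. }
    rewrite Hd. apply Rmult_lt_compat_l; [exact HQ|].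
    assert (cos (t - c) < cos (t + c)) by (apply cos_lt_abs; lra). lra. }
  assert (L : rP W * cos (6 * t) < d).
  { assert (rP W * cos (6 * t) < rP W * cos (2 * t + c)) by (apply rP_smono; lra). lra. }
  exists (wl W (sq W) (-1) (- c) d),
    (wl W (sf W) 1 (2 * t + c) d :: wl W (sp W) 1 c d :: nil).
  split; [simpl; lia|]. subst t c.
  assert (E : d + d = rP W * (cos (2 * tau W + dev W) + cos (dev W))) by (unfold d; lra).
  clearbody d. closed_path.
Qed.

(* In the remaining wedges the path starts perpendicularly to a wall, reaches a
   wall perpendicularly again and then retraces itself.  The distance [d] of
   the first leg may be chosen in an open interval, whose ends are given by the
   vertices of the floor that must lie on the correct side of the legs. *)
Lemma path_right (V : nat -> pt) (W : wedge V) : dev W = 0 -> has_short_path V.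
Proof.
  intros Hc. wedge_facts W. set (t := tau W) in *.
  assert (Ha : rP W * cos (2 * t) < rQ W * cos t).
  { apply rP_lt_rQ. fold t. rewrite Hc.
    replace (t - (t + 0)) with 0 by ring. rewrite cos_0.
    replace (2 * t + 0) with (2 * t) by ring. replace (2 * t - 0) with (2 * t) by ring.
    replace (t + (t + 0)) with (2 * t) by ring.
    assert (cos (2 * t) < cos 0) by (apply cos_lt_abs; lra). rewrite cos_0 in *. lra. }
  set (d := (rP W * cos (2 * t) + rQ W * cos t) / 2).
  set (d2 := rP W * (cos (2 * t) + cos 0) - d).
  assert (E : d + d2 = rP W * (cos (2 * t) + cos 0)) by (unfold d2; ring).
  pose proof (floor_sum V W (2 * t) 0 ltac:(fold t; lra)) as F. fold t in F.
  rewrite (cos_pm t (t - 2 * t)) in F by (right; ring).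
  replace (t - 0) with t in F by ring.
  assert (A1 : rP W * cos (2 * t) < d) by (unfold d; lra).
  assert (A2 : d < rQ W * cos t) by (unfold d; lra).
  assert (A3 : d2 < rP W * cos 0) by lra.
  assert (A4 : rQ W * cos t < d2) by lra.
  assert (L : rP W * cos (6 * t) < d).
  { assert (rP W * cos (6 * t) < rP W * cos (2 * t)) by (apply rP_smono; lra). lra. }
  assert (L2 : rP W * cos (6 * t) < d2) by lra.
  assert (C1 : d < rP W * cos 0) by lra.
  exists (wl W (sq W) (-1) 0 d),
    (wl W (sf W) 1 (2 * t) d :: wl W (sp W) 1 0 d2 :: wl W (sf W) (-1) 0 d2
     :: wl W (sq W) (-1) (2 * t) d :: wl W (sp W) 1 0 d :: nil).
  split; [simpl; lia|]. subst t. clearbody d d2. closed_path.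
Qed.

(** Normal angle [0] means perpendicular to the wall [sp]. The path reaches the floor at angle
    [4 t], bounces between the walls, reaches it again at [2 t + 2 c], and leaves at angle [0]. *)
Lemma path_obtuse_small (V : nat -> pt) (W : wedge V) :
  0 < dev W < tau W / 2 -> has_short_path V.
Proof.
  intros Hc. wedge_facts W. set (t := tau W) in *. set (c := dev W) in *.
  pose proof (rP_smono V W) as SP.
  pose proof (rQ_smono V W) as SQ.
  (* The outer bounds on [d2] are those on [d] at the first floor bounce, carried over by
     [floor_sum]; the inner ones come from the second floor bounce. The second and third comparisons
     amount to [2 * c < t] and [0 < c]. *)
  destruct (between_four (rQ W * cos (3 * t - 2 * c)) (rP W * cos (2 * t + 2 * c))
    (rP W * cos (2 * t - 2 * c)) (rQ W * cos (t + 2 * c))) as (d2 & A1 & A2 & A3 & A4).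
  - apply rQ_lt_rP. fold t c.
    apply Rplus_lt_le_compat; [apply cos_lt_abs | apply cos_le_abs]; lra.
  - apply SQ; lra.
  - apply SP; lra.
  - apply rP_lt_rQ. fold t c.
    assert (cos (2 * t + 2 * c - c) < cos (t + 2 * c - (t + c))) by (apply cos_lt_abs; lra).
    replace (t + 2 * c + (t + c)) with (2 * t + 2 * c + c) by ring. lra.
  - set (d := rP W * (cos (4 * t) + cos (2 * t - 2 * c)) - d2).
    set (d3 := rP W * (cos (2 * t + 2 * c) + cos 0) - d2).
    assert (E : d + d2 = rP W * (cos (4 * t) + cos (2 * t - 2 * c))) by (unfold d; ring).
    assert (E3 : d2 + d3 = rP W * (cos (2 * t + 2 * c) + cos 0)) by (unfold d3; ring).
    pose proof (floor_sum V W (4 * t) (2 * c - 2 * t) ltac:(fold t c; lra)) as F.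
    pose proof (floor_sum V W (2 * t + 2 * c) 0 ltac:(fold t c; lra)) as F3.
    fold t in F, F3.
    rewrite (cos_pm (2 * t - 2 * c) (2 * c - 2 * t)) in F by (right; ring).
    rewrite (cos_pm (3 * t) (t - 4 * t)) in F by (right; ring).
    replace (t - (2 * c - 2 * t)) with (3 * t - 2 * c) in F by ring.
    rewrite (cos_pm (t + 2 * c) (t - (2 * t + 2 * c))) in F3 by (right; ring).
    replace (t - 0) with t in F3 by ring.
    assert (A5 : rP W * cos (4 * t) < d) by lra.
    assert (A6 : d < rQ W * cos (3 * t)) by lra.
    assert (A7 : d3 < rP W * cos 0) by lra.
    assert (A8 : rQ W * cos t < d3) by lra.
    assert (B1 : rP W * cos (6 * t) < rP W * cos (4 * t)) by (apply SP; lra).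
    assert (B2 : rP W * cos (6 * t) < rP W * cos (2 * t + 2 * c)) by (apply SP; lra).
    assert (B3 : rQ W * cos (t + 2 * c) < rQ W * cos t) by (apply SQ; lra).
    assert (L : rP W * cos (6 * t) < d) by lra.
    assert (L2 : rP W * cos (6 * t) < d2) by lra.
    assert (L3 : rP W * cos (6 * t) < d3) by lra.
    assert (E' : d + d2 = rP W * (cos (4 * t) + cos (2 * c - 2 * t)))
      by (rewrite (cos_pm (2 * t - 2 * c) (2 * c - 2 * t)) by (right; ring); exact E).
    assert (C1 : d < rP W * cos (2 * t)).
    { assert (rP W * cos (2 * t) > rP W * cos (4 * t)) by (apply SP; lra).
      assert (rQ W * cos (3 * t) < rP W * cos (2 * t)); [|lra].
      apply rQ_lt_rP; fold t c.
      apply Rplus_lt_le_compat; [apply cos_lt_abs | apply cos_le_abs]; lra. }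
    exists (wl W (sq W) (-1) 0 d),
      (wl W (sp W) 1 (2 * t) d :: wl W (sq W) (-1) (- 2 * t) d :: wl W (sf W) 1 (4 * t) d ::
       wl W (sp W) 1 (2 * c - 2 * t) d2 :: wl W (sq W) (-1) (2 * t - 2 * c) d2 ::
       wl W (sp W) 1 (2 * c) d2 :: wl W (sq W) (-1) (- 2 * c) d2 ::
       wl W (sf W) 1 (2 * t + 2 * c) d2 ::
       wl W (sp W) 1 0 d3 :: wl W (sf W) (-1) 0 d3 ::
       wl W (sq W) (-1) (2 * t + 2 * c) d2 :: wl W (sp W) 1 (- 2 * c) d2 ::
       wl W (sq W) (-1) (2 * c) d2 :: wl W (sp W) 1 (2 * t - 2 * c) d2 ::
       wl W (sf W) (-1) (2 * c - 2 * t) d2 ::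
       wl W (sq W) (-1) (4 * t) d :: wl W (sp W) 1 (- 2 * t) d ::
       wl W (sq W) (-1) (2 * t) d :: wl W (sp W) 1 0 d :: nil).
    split; [simpl; lia|]. subst t c. clearbody d d3. closed_path.
Qed.

(** With [delta = tau + dev], the hypothesis says [dev = delta / 3]. After the floor bounce the
    normal angle becomes [t] on the way to [sq]: the leg is perpendicular to that wall and the path
    turns back there. *)
Lemma path_obtuse_third (V : nat -> pt) (W : wedge V) :
  dev W = tau W / 2 -> has_short_path V.
Proof.
  intros Hc. wedge_facts W. set (t := tau W) in *. set (c := dev W) in *.
  pose proof (rP_smono V W) as SP. pose proof (rQ_smono V W) as SQ.
  assert (A0 : rQ W * cos (2 * t) < rP W * cos t).
  { apply rQ_lt_rP. fold t c.
    apply Rplus_lt_le_compat; [apply cos_lt_abs | apply cos_le_abs]; lra. }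
  destruct (between_four (rQ W * cos (2 * t)) (rQ W * cos (2 * t))
    (rP W * cos t) (rQ W * cos 0)) as (d2 & A1 & _ & A3 & A4);
    [exact A0 | apply SQ; lra | exact A0 | apply SQ; lra |].
  set (d := rP W * (cos (4 * t) + cos (- t)) - d2).
  assert (E : d + d2 = rP W * (cos (4 * t) + cos (- t))) by (unfold d; ring).
  pose proof (floor_sum V W (4 * t) (- t) ltac:(fold t c; lra)) as F. fold t in F.
  rewrite (cos_pm t (- t)) in E by (right; ring).
  rewrite (cos_pm t (- t)) in F by (right; ring).
  rewrite (cos_pm (3 * t) (t - 4 * t)) in F by (right; ring).
  replace (t - - t) with (2 * t) in F by ring.
  assert (A5 : rP W * cos (4 * t) < d) by lra.
  assert (A6 : d < rQ W * cos (3 * t)) by lra.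
  assert (E' : d + d2 = rP W * (cos (4 * t) + cos (- t)))
    by (rewrite (cos_pm t (- t)) by (right; ring); exact E).
  assert (B1 : rP W * cos (6 * t) < rP W * cos (4 * t)) by (apply SP; lra).
  assert (B2 : rP W * cos (6 * t) < rQ W * cos (2 * t)).
  { apply rP_lt_rQ. fold t c. apply Rplus_lt_compat; apply cos_lt_abs; lra. }
  assert (L : rP W * cos (6 * t) < d) by lra.
  assert (L2 : rP W * cos (6 * t) < d2) by lra.
  assert (C1 : d < rP W * cos (2 * t)).
  { assert (rQ W * cos (3 * t) < rP W * cos (2 * t)); [|lra].
    apply rQ_lt_rP; fold t c.
    apply Rplus_lt_le_compat; [apply cos_lt_abs | apply cos_le_abs]; lra. }
  exists (wl W (sq W) (-1) 0 d),
    (wl W (sp W) 1 (2 * t) d :: wl W (sq W) (-1) (- 2 * t) d :: wl W (sf W) 1 (4 * t) d ::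
     wl W (sp W) 1 (- t) d2 :: wl W (sq W) (-1) t d2 :: wl W (sp W) 1 t d2 ::
     wl W (sf W) (-1) (- t) d2 ::
     wl W (sq W) (-1) (4 * t) d :: wl W (sp W) 1 (- 2 * t) d ::
     wl W (sq W) (-1) (2 * t) d :: wl W (sp W) 1 0 d :: nil).
  split; [simpl; lia|]. subst t c. clearbody d. closed_path.
Qed.

(** Compared with the small case, there are two more wall bounces on either side of the first floor
    bounce, which moves the range where [d2] exists to [t / 2 < c < t]. The angle [6 t] is the
    largest in any of the paths, whence [6 * tau] in [wedge]; the 28 legs are the most in any of
    them. *)
Lemma path_obtuse_large (V : nat -> pt) (W : wedge V) :
  tau W / 2 < dev W < tau W -> has_short_path V.
Proof.
  intros Hc. wedge_facts W. set (t := tau W) in *. set (c := dev W) in *.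
  pose proof (rP_smono V W) as SP. pose proof (rQ_smono V W) as SQ.
  (* Here the second and third comparisons amount to [c < t] and [t < 2 * c]. *)
  destruct (between_four (rQ W * cos (5 * t - 2 * c)) (rP W * cos (2 * t + 2 * c))
    (rP W * cos (4 * t - 2 * c)) (rQ W * cos (t + 2 * c))) as (d2 & A1 & A2 & A3 & A4).
  - apply rQ_lt_rP. fold t c.
    apply Rplus_lt_le_compat; [apply cos_lt_abs | apply cos_le_abs]; lra.
  - apply SQ; lra.
  - apply SP; lra.
  - apply rP_lt_rQ. fold t c.
    assert (cos (2 * t + 2 * c - c) < cos (t + 2 * c - (t + c))) by (apply cos_lt_abs; lra).
    replace (t + 2 * c + (t + c)) with (2 * t + 2 * c + c) by ring. lra.
  - set (d := rP W * (cos (6 * t) + cos (4 * t - 2 * c)) - d2).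
    set (d3 := rP W * (cos (2 * t + 2 * c) + cos 0) - d2).
    assert (E : d + d2 = rP W * (cos (6 * t) + cos (4 * t - 2 * c))) by (unfold d; ring).
    assert (E3 : d2 + d3 = rP W * (cos (2 * t + 2 * c) + cos 0)) by (unfold d3; ring).
    pose proof (floor_sum V W (6 * t) (2 * c - 4 * t) ltac:(fold t c; lra)) as F.
    pose proof (floor_sum V W (2 * t + 2 * c) 0 ltac:(fold t c; lra)) as F3.
    fold t in F, F3.
    rewrite (cos_pm (4 * t - 2 * c) (2 * c - 4 * t)) in F by (right; ring).
    rewrite (cos_pm (5 * t) (t - 6 * t)) in F by (right; ring).
    replace (t - (2 * c - 4 * t)) with (5 * t - 2 * c) in F by ring.
    rewrite (cos_pm (t + 2 * c) (t - (2 * t + 2 * c))) in F3 by (right; ring).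
    replace (t - 0) with t in F3 by ring.
    assert (E' : d + d2 = rP W * (cos (6 * t) + cos (2 * c - 4 * t)))
      by (rewrite (cos_pm (4 * t - 2 * c) (2 * c - 4 * t)) by (right; ring); exact E).
    assert (A5 : rP W * cos (6 * t) < d) by lra.
    assert (A6 : d < rQ W * cos (5 * t)) by lra.
    assert (A7 : d3 < rP W * cos 0) by lra.
    assert (A8 : rQ W * cos t < d3) by lra.
    assert (B2 : rP W * cos (6 * t) < rP W * cos (2 * t + 2 * c)) by (apply SP; lra).
    assert (B3 : rQ W * cos (t + 2 * c) < rQ W * cos t) by (apply SQ; lra).
    assert (L2 : rP W * cos (6 * t) < d2) by lra.
    assert (L3 : rP W * cos (6 * t) < d3) by lra.
    assert (C1 : d < rP W * cos (4 * t)).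
    { assert (rQ W * cos (5 * t) < rP W * cos (4 * t)); [|lra].
      apply rQ_lt_rP; fold t c.
      apply Rplus_lt_le_compat; [apply cos_lt_abs | apply cos_le_abs]; lra. }
    exists (wl W (sq W) (-1) 0 d),
      (wl W (sp W) 1 (2 * t) d :: wl W (sq W) (-1) (- 2 * t) d ::
       wl W (sp W) 1 (4 * t) d :: wl W (sq W) (-1) (- 4 * t) d :: wl W (sf W) 1 (6 * t) d ::
       wl W (sp W) 1 (2 * c - 4 * t) d2 :: wl W (sq W) (-1) (4 * t - 2 * c) d2 ::
       wl W (sp W) 1 (2 * c - 2 * t) d2 :: wl W (sq W) (-1) (2 * t - 2 * c) d2 ::
       wl W (sp W) 1 (2 * c) d2 :: wl W (sq W) (-1) (- 2 * c) d2 ::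
       wl W (sf W) 1 (2 * t + 2 * c) d2 ::
       wl W (sp W) 1 0 d3 :: wl W (sf W) (-1) 0 d3 ::
       wl W (sq W) (-1) (2 * t + 2 * c) d2 :: wl W (sp W) 1 (- 2 * c) d2 ::
       wl W (sq W) (-1) (2 * c) d2 :: wl W (sp W) 1 (2 * t - 2 * c) d2 ::
       wl W (sq W) (-1) (2 * c - 2 * t) d2 :: wl W (sp W) 1 (4 * t - 2 * c) d2 ::
       wl W (sf W) (-1) (2 * c - 4 * t) d2 ::
       wl W (sq W) (-1) (6 * t) d :: wl W (sp W) 1 (- 4 * t) d ::
       wl W (sq W) (-1) (4 * t) d :: wl W (sp W) 1 (- 2 * t) d ::
       wl W (sq W) (-1) (2 * t) d :: wl W (sp W) 1 0 d :: nil).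
    split; [simpl; lia|]. subst t c. clearbody d d3. closed_path.
Qed.

(** Here [dev] is half of [tau + dev]. The first floor bounce, at angle [4 t], already sends the
    path perpendicularly to [sp], since [2 * (t + c) - 4 * t = 0]. *)
Lemma path_obtuse_half (V : nat -> pt) (W : wedge V) :
  dev W = tau W -> has_short_path V.
Proof.
  intros Hc. wedge_facts W. set (t := tau W) in *. set (c := dev W) in *.
  pose proof (rP_smono V W) as SP. pose proof (rQ_smono V W) as SQ.
  assert (A0 : rP W * cos (4 * t) < rQ W * cos (3 * t)).
  { apply rP_lt_rQ. fold t c.
    apply Rplus_le_lt_compat; [apply cos_le_abs | apply cos_lt_abs]; lra. }
  set (d := (rP W * cos (4 * t) + rQ W * cos (3 * t)) / 2).
  set (d2 := rP W * (cos (4 * t) + cos 0) - d).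
  assert (E : d + d2 = rP W * (cos (4 * t) + cos 0)) by (unfold d2; ring).
  pose proof (floor_sum V W (4 * t) 0 ltac:(fold t c; lra)) as F. fold t in F.
  rewrite (cos_pm (3 * t) (t - 4 * t)) in F by (right; ring).
  replace (t - 0) with t in F by ring.
  assert (A5 : rP W * cos (4 * t) < d) by (unfold d; lra).
  assert (A6 : d < rQ W * cos (3 * t)) by (unfold d; lra).
  assert (A7 : d2 < rP W * cos 0) by lra.
  assert (A8 : rQ W * cos t < d2) by lra.
  assert (B1 : rP W * cos (6 * t) < rP W * cos (4 * t)) by (apply SP; lra).
  assert (B2 : rQ W * cos (3 * t) < rQ W * cos t) by (apply SQ; lra).
  assert (L : rP W * cos (6 * t) < d) by lra.
  assert (L2 : rP W * cos (6 * t) < d2) by lra.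
  assert (C1 : d < rP W * cos (2 * t)).
  { assert (rQ W * cos (3 * t) < rP W * cos (2 * t)); [|lra].
    apply rQ_lt_rP; fold t c.
    apply Rplus_lt_le_compat; [apply cos_lt_abs | apply cos_le_abs]; lra. }
  exists (wl W (sq W) (-1) 0 d),
    (wl W (sp W) 1 (2 * t) d :: wl W (sq W) (-1) (- 2 * t) d :: wl W (sf W) 1 (4 * t) d ::
     wl W (sp W) 1 0 d2 :: wl W (sf W) (-1) 0 d2 ::
     wl W (sq W) (-1) (4 * t) d :: wl W (sp W) 1 (- 2 * t) d ::
     wl W (sq W) (-1) (2 * t) d :: wl W (sp W) 1 0 d :: nil).
  split; [simpl; lia|]. subst t c. clearbody d d2. closed_path.
Qed.

Lemma path_wedge (V : nat -> pt) (W : wedge V) :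
  0 < tau W + dev W -> has_short_path V.
Proof.
  intro Ht. pose proof (dev_small V W) as [_ Hd].
  destruct (Rtotal_order (dev W) 0) as [H|[H|H]].
  - apply (path_acute V W); assumption.
  - apply (path_right V W); assumption.
  - destruct (Rtotal_order (dev W) (tau W / 2)) as [K|[K|K]].
    + apply (path_obtuse_small V W); lra.
    + apply (path_obtuse_third V W); assumption.
    + destruct Hd as [Hd|Hd].
      * apply (path_obtuse_large V W); lra.
      * apply (path_obtuse_half V W); assumption.
Qed.

(** * Trigonometric estimates and the construction of a wedge *)

Lemma sin_ge_half (x : R) : 0 <= x <= 1 -> x / 2 <= sin x.
Proof.
  intro Hx. destruct (pre_sin_bound x 0) as [H _]; try lra.
  unfold sin_approx, sin_term in H. cbn -[Rmult Rplus Ropp Rdiv Rinv INR] in H.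
  simpl in H. nra.
Qed.

Lemma sin_abs_le (x : R) : Rabs (sin x) <= Rabs x.
Proof.
  destruct (Rtotal_order x 0) as [H|[->|H]].
  - rewrite <- (Rabs_Ropp (sin x)), <- sin_neg, <- (Rabs_Ropp x).
    destruct (Rle_dec (- x) 1) as [K|K].
    + rewrite !Rabs_right; try lra.
      * left; apply sin_lt_x; lra.
      * pose proof (sin_ge_half (- x) ltac:(lra)). lra.
    + pose proof (SIN_bound (- x)). rewrite (Rabs_right (- x)) by lra.
      apply Rabs_le; lra.
  - rewrite sin_0. lra.
  - destruct (Rle_dec x 1) as [K|K].
    + rewrite !Rabs_right; try lra.
      * left; apply sin_lt_x; lra.
      * pose proof (sin_ge_half x ltac:(lra)). lra.
    + pose proof (SIN_bound x). rewrite (Rabs_right x) by lra. apply Rabs_le; lra.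
Qed.

Lemma cos_ge_quad (x : R) : 1 - x * x / 2 <= cos x.
Proof.
  replace x with (2 * (x / 2)) at 3 by field.
  rewrite cos_2a_sin.
  pose proof (sin_abs_le (x / 2)) as H. apply Rsqr_le_abs_1 in H. unfold Rsqr in H. lra.
Qed.

Lemma ray_decomp (o w t : R) : o = 1 \/ o = -1 ->
  ray o w t = padd (pscale (cos t) (ray o w 0)) (pscale (sin t) (ray o w (PI / 2))).
Proof.
  intro Ho. unfold ray.
  assert (Hc : cos (o * t) = cos t).
  { destruct Ho as [->| ->]; [f_equal; ring | rewrite <- cos_neg; f_equal; ring]. }
  assert (Hs : sin (o * t) = o * sin t).
  { destruct Ho as [->| ->]; [rewrite Rmult_1_l; ring_simplify; f_equal; ring|].
    replace (-1 * t) with (- t) by ring. rewrite sin_neg; ring. }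
  assert (Hc' : cos (o * (PI / 2)) = 0).
  { destruct Ho as [->| ->]; [rewrite Rmult_1_l; apply cos_PI2|].
    replace (-1 * (PI / 2)) with (- (PI / 2)) by ring. rewrite cos_neg; apply cos_PI2. }
  assert (Hs' : sin (o * (PI / 2)) = o).
  { destruct Ho as [->| ->]; [rewrite Rmult_1_l; apply sin_PI2|].
    replace (-1 * (PI / 2)) with (- (PI / 2)) by ring. rewrite sin_neg, sin_PI2; ring. }
  unfold dirv, padd, pscale; apply pt_eq; simpl;
    rewrite ?cos_plus, ?sin_plus, Hc, Hs, Hc', Hs', !Rmult_0_r, cos_0, sin_0; ring.
Qed.

(** Law of sines in the triangle with base [l], base angles [PI / 2 - (t + c)] and [PI / 2 + c], and
    apex angle [t]. *)
Lemma apex_triangle (o w t c l : R) : o = 1 \/ o = -1 -> sin t <> 0 ->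
  psub (pscale (l * cos (t + c) / sin t) (ray o w t)) (pscale (l * cos c / sin t) (ray o w 0))
  = pscale l (ray o w (t + c + PI / 2)).
Proof.
  intros Ho Hs. rewrite (ray_decomp o w t Ho), (ray_decomp o w (t + c + PI / 2) Ho).
  rewrite (cos_plus (t + c) (PI / 2)), (sin_plus (t + c) (PI / 2)), cos_PI2, sin_PI2, (cos_plus t c), (sin_plus t c).
  generalize (ray o w 0) (ray o w (PI / 2)); intros [u1 u2] [v1 v2].
  pose proof (sin2_cos2 t) as Hp. unfold Rsqr in Hp.
  unfold psub, padd, pscale; apply pt_eq; simpl; apply Rminus_diag_uniq.
  - transitivity (l * cos c / sin t * u1 * (sin t * sin t + cos t * cos t - 1));
      [field; exact Hs | rewrite Hp; ring].
  - transitivity (l * cos c / sin t * u2 * (sin t * sin t + cos t * cos t - 1));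
      [field; exact Hs | rewrite Hp; ring].
Qed.

(** The apex is at a distance of order [l / t], while the legs stray from the floor only by an
    amount of order [l * t]. So the far ends of the walls lie behind the legs once [t] is small
    against [lam]. *)
Lemma make_wedge (V : nat -> pt) (o w t c l lS lT lam : R) (P Q S T : pt) (ip iq ifl : nat) :
  o = 1 \/ o = -1 ->
  ends V o ip S P -> ends V o iq Q T -> ends V o ifl P Q ->
  psub P S = pscale lS (ray o w 0) -> psub Q T = pscale lT (ray o w t) ->
  psub Q P = pscale l (ray o w (t + c + PI / 2)) ->
  lam <= l <= 2 -> lam <= lS <= 2 -> lam <= lT <= 2 ->
  0 < t -> 160 * t <= lam -> - t <= c <= t -> 0 < t + c ->
  has_short_path V.
Proof.
  intros Ho Ep Eq Ef HS HT HQ Hl HlS HlT Ht Htl Hc Htc.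
  pose proof (sin_ge_half t ltac:(lra)) as Hs1.
  pose proof (sin_lt_x t Ht) as Hs2.
  assert (Hs : 0 < sin t) by lra.
  pose proof (cos_ge_quad c) as Q1. pose proof (cos_ge_quad (t + c)) as Q2.
  pose proof (cos_ge_quad (6 * t)) as Q3.
  pose proof (COS_bound c) as B1. pose proof (COS_bound (t + c)) as B2.
  pose proof (COS_bound (6 * t)) as B3.
  assert (Hcc : c * c <= t * t) by nra.
  assert (Htt : t * t <= t / 80) by nra.
  set (rP := l * cos c / sin t). set (rQ := l * cos (t + c) / sin t).
  set (O := psub P (pscale rP (ray o w 0))).
  assert (EP : polar O o w rP 0 = P)
    by (unfold polar, O, padd, psub, pscale; apply pt_eq; simpl; ring).
  assert (EQ : polar O o w rQ t = Q).
  { pose proof (apex_triangle o w t c l Ho ltac:(lra)) as Ha.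
    fold rP rQ in Ha. rewrite <- HQ in Ha. revert Ha.
    unfold polar, O, padd, psub, pscale. intro Ha. injection Ha as Ha1 Ha2.
    apply pt_eq; simpl; lra. }
  assert (ES : polar O o w (rP - lS) 0 = S).
  { revert EP HS. unfold polar, padd, psub, pscale. intros EP HS.
    apply (f_equal fst) in EP as EP1. apply (f_equal snd) in EP as EP2.
    injection HS as HS1 HS2. apply pt_eq; simpl in *; lra. }
  assert (ET : polar O o w (rQ - lT) t = T).
  { revert EQ HT. unfold polar, padd, psub, pscale. intros EQ HT.
    apply (f_equal fst) in EQ as EQ1. apply (f_equal snd) in EQ as EQ2.
    injection HT as HT1 HT2. apply pt_eq; simpl in *; lra. }
  assert (HP : rP * sin t = l * cos c) by (unfold rP; field; lra).
  assert (HQ' : rQ * sin t = l * cos (t + c)) by (unfold rQ; field; lra).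
  assert (P1 : lS < rP).
  { apply Rmult_lt_reg_r with (sin t); [exact Hs|]. rewrite HP. nra. }
  assert (P2 : lT < rQ).
  { apply Rmult_lt_reg_r with (sin t); [exact Hs|]. rewrite HQ'. nra. }
  (* After multiplication by [sin t >= t / 2] a wall contributes at least [80 * t * t], because
     [160 * t <= lam]. This exceeds the [36 * t * t] needed here and the [38 * t * t] needed for the
     other wall. *)
  assert (P3 : rP - lS < rP * cos (6 * t)).
  { apply Rmult_lt_reg_r with (sin t); [exact Hs|].
    assert (rP * sin t * (1 - cos (6 * t)) <= 2 * (18 * (t * t))).
    { rewrite HP. apply Rmult_le_compat; nra. }
    nra. }
  assert (P4 : rQ - lT < rP * cos (6 * t)).
  { apply Rmult_lt_reg_r with (sin t); [exact Hs|].
    assert (rQ * sin t - rP * sin t * cos (6 * t) <= 2 * (19 * (t * t))).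
    { rewrite HP, HQ'.
      replace (l * cos (t + c) - l * cos c * cos (6 * t))
        with (l * (cos (t + c) - cos c * cos (6 * t))) by ring.
      apply Rle_trans with (l * (19 * (t * t))); [|nra].
      apply Rmult_le_compat_l; [lra|].
      assert (0 <= (1 - cos c) * (1 - cos (6 * t))) by (apply Rmult_le_pos; lra).
      lra. }
    nra. }
  assert (Hfh : rP * cos (t + c) = rQ * cos c) by (unfold rP, rQ; field; lra).
  unshelve refine (path_wedge V (@Wedge V O o w t c l rP rQ (rP - lS) (rQ - lT) ip iq ifl
     _ _ _ _ _ _ _ _ _ _ _ _ _ _) _).
  all: rewrite ?EP, ?EQ, ?ES, ?ET; try assumption; try lra.
Qed.

(** * Paths across the quadrilateral and along a diagonal *)

(* [fdef i] is the interior angle at vertex [i] minus [PI / 2]. *)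
Record framed (V : nat -> pt) := Framed {
  flen : nat -> R; fdir : nat -> R; fdef : nat -> R;
  frame_side : forall i, psub (V (S i)) (V i) = pscale (flen i) (dirv (fdir i));
  frame_turn : forall i, fdir (S i) = fdir i + PI / 2 - fdef (S i);
  frame_period : forall i, V (i + 4)%nat = V i;
  frame_len : forall i, 0 < flen i;
  frame_full : forall i, fdir (i + 4)%nat = fdir i + 2 * PI
}.
Arguments flen {V}. Arguments fdir {V}. Arguments fdef {V}.

Lemma cross_dirv (k l s t : R) :
  cross (pscale k (dirv s)) (pscale l (dirv t)) = k * l * sin (t - s).
Proof. unfold cross, pscale, dirv; simpl. rewrite sin_minus. ring. Qed.

Lemma framed_next (V : nat -> pt) (F : framed V) (i : nat) :
  V (S i) = padd (V i) (pscale (flen F i) (dirv (fdir F i))).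
Proof.
  rewrite <- (frame_side V F i). unfold padd, psub; apply pt_eq; simpl; ring.
Qed.

Lemma framed_prev (V : nat -> pt) (F : framed V) (i : nat) :
  V (i + 3)%nat = psub (V i) (pscale (flen F (i + 3)%nat) (dirv (fdir F (i + 3)%nat))).
Proof.
  rewrite <- (frame_side V F (i + 3)%nat).
  replace (S (i + 3)) with (i + 4)%nat by lia. rewrite (frame_period V F).
  unfold psub; apply pt_eq; simpl; ring.
Qed.

Lemma framed_prev_dir (V : nat -> pt) (F : framed V) (i : nat) :
  fdir F (i + 3)%nat = fdir F i + 2 * PI - PI / 2 + fdef F (i + 4)%nat.
Proof.
  pose proof (frame_turn V F (i + 3)%nat) as H.
  replace (S (i + 3)) with (i + 4)%nat in H by lia.
  rewrite (frame_full V F) in H. lra.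
Qed.

Lemma framed_convex (V : nat -> pt) (F : framed V) :
  (forall i, Rabs (fdef F i) < 1) -> convex_quad V.
Proof.
  intro Hd. split; [apply (frame_period V F)|]. intro i.
  assert (Hcos : forall j, 0 < cos (fdef F j)).
  { intro j. specialize (Hd j). apply Rabs_def2 in Hd. pose proof PI2_1.
    apply cos_gt_0; lra. }
  pose proof (frame_len V F) as Hl. unfold side_height. split.
  - replace (cross _ _) with (cross (psub (V (S i)) (V i)) (psub (V (S (S i))) (V (S i)))).
    + rewrite !(frame_side V F), cross_dirv.
      rewrite (frame_turn V F i).
      replace (fdir F i + PI / 2 - fdef F (S i) - fdir F i) with (PI / 2 - fdef F (S i)) by ring.
      rewrite sin_shift. repeat apply Rmult_lt_0_compat; auto.
    + replace (i + 2)%nat with (S (S i)) by lia. unfold cross, psub; simpl; ring.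
  - replace (psub (V (i + 3)%nat) (V i)) with
      (pscale (- flen F (i + 3)%nat) (dirv (fdir F (i + 3)%nat)))
      by (rewrite (framed_prev V F); unfold psub, pscale; apply pt_eq; simpl; ring).
    rewrite (frame_side V F), cross_dirv, framed_prev_dir.
    replace (fdir F i + 2 * PI - PI / 2 + fdef F (i + 4)%nat - fdir F i) with
      (- (PI / 2 - fdef F (i + 4)%nat) + 2 * PI) by ring.
    rewrite sin_plus, sin_2PI, cos_2PI, sin_neg, sin_shift.
    pose proof (Hcos (i + 4)%nat). pose proof (Hl i). pose proof (Hl (i + 3)%nat).
    assert (0 < flen F i * flen F (i + 3)%nat * cos (fdef F (i + 4)%nat))
      by (repeat apply Rmult_lt_0_compat; auto).
    lra.
Qed.

(** The defect of vertex 0 is read at index 4, because [frame_turn] speaks of successors only. *)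
Lemma path_rectangle (V : nat -> pt) (F : framed V) :
  fdef F 1%nat = 0 -> fdef F 2%nat = 0 -> fdef F 4%nat = 0 -> has_short_path V.
Proof.
  intros D1 D2 D4. set (u := dirv (fdir F 0%nat)).
  pose proof (frame_len V F 0%nat) as Hl.
  assert (Hu : pdot u u = 1) by (unfold u; rewrite pdot_dirv, Rminus_diag; apply cos_0).
  assert (Hd1 : fdir F 1%nat = fdir F 0%nat + PI / 2)
    by (rewrite (frame_turn V F 0%nat), D1; ring).
  assert (Hd2 : fdir F 2%nat = fdir F 0%nat + PI)
    by (rewrite (frame_turn V F 1%nat), D2, Hd1; field).
  assert (Hp0 : pdot u (V 1%nat) = pdot u (V 0%nat) + flen F 0%nat).
  { rewrite (framed_next V F 0%nat). fold u.
    transitivity (pdot u (V 0%nat) + flen F 0%nat * pdot u u);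
      [unfold pdot, padd, pscale; simpl; ring | rewrite Hu; ring]. }
  assert (Hp1 : pdot u (V 2%nat) = pdot u (V 1%nat)).
  { rewrite (framed_next V F 1%nat).
    transitivity (pdot u (V 1%nat) + flen F 1%nat * pdot u (dirv (fdir F 1%nat)));
      [unfold pdot, padd, pscale; simpl; ring|].
    unfold u. rewrite pdot_dirv, Hd1.
    replace (fdir F 0%nat - (fdir F 0%nat + PI / 2)) with (- (PI / 2)) by ring.
    rewrite cos_neg, cos_PI2; ring. }
  assert (Hp3 : pdot u (V 3%nat) = pdot u (V 0%nat)).
  { rewrite (framed_prev V F 0%nat : V 3%nat = _).
    transitivity (pdot u (V 0%nat) - flen F 3%nat * pdot u (dirv (fdir F 3%nat)));
      [unfold pdot, psub, pscale; simpl; ring|].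
    unfold u. rewrite pdot_dirv, (framed_prev_dir V F 0%nat : fdir F 3%nat = _).
    change (fdef F (0 + 4)%nat) with (fdef F 4%nat). rewrite D4.
    replace (fdir F 0%nat - (fdir F 0%nat + 2 * PI - PI / 2 + 0)) with (PI / 2 - 2 * PI) by ring.
    rewrite cos_minus, cos_PI2, sin_2PI; ring. }
  assert (Hr : forall k s, k <> 0 ->
     pscale (-1) (reflect (pscale k u) (pscale s u)) = pscale (- s) u).
  { intros k s Hk. rewrite reflect_scale. unfold u. rewrite reflect_dirv by exact Hk.
    replace (2 * fdir F 0%nat - fdir F 0%nat) with (fdir F 0%nat) by ring.
    unfold pscale; apply pt_eq; simpl; ring. }
  set (m := pdot u (V 0%nat) + flen F 0%nat / 2).
  exists (Leg 0 (pscale 1 u) m), (Leg 2 (pscale (-1) u) (- m) :: nil).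
  split; [simpl; lia|].
  assert (Hv : forall s k i z, leval (Leg i (pscale s u) k) z = s * pdot u z - k)
    by (intros; unfold leval, pdot, pscale; simpl; ring).
  unfold bounces, bounce; simpl. rewrite !Hv.
  rewrite (frame_side V F 0%nat), (frame_side V F 2%nat). fold u. rewrite Hd2, dirv_add_PI. fold u.
  pose proof (frame_len V F 2%nat) as Hl2.
  repeat split; try (unfold m; lra).
  - rewrite Hr; [reflexivity | lra].
  - replace (pscale (flen F 2%nat) (pscale (-1) u)) with (pscale (- flen F 2%nat) u)
      by (unfold pscale; apply pt_eq; simpl; ring).
    rewrite Hr; [|lra]. f_equal. ring.
Qed.

Lemma polar_form (v : pt) : 0 < pdot v v ->
  exists L w, 0 < L /\ v = pscale L (dirv w).
Proof.
  intro Hv. set (L := sqrt (pdot v v)).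
  assert (HL : 0 < L) by (apply sqrt_lt_R0; exact Hv).
  assert (HLL : L * L = pdot v v) by (apply sqrt_sqrt; lra).
  clearbody L. destruct v as [x y]. unfold pdot in *; simpl in *.
  assert (Hxy : 1 - (x / L)² = (y / L)²).
  { unfold Rsqr. apply Rmult_eq_reg_r with (L * L); [|nra].
    replace ((1 - x / L * (x / L)) * (L * L)) with (L * L - x * x) by (field; lra).
    replace (y / L * (y / L) * (L * L)) with (y * y) by (field; lra). lra. }
  assert (Hb : -1 <= x / L <= 1).
  { pose proof (Rle_0_sqr (y / L)). unfold Rsqr in *. split; nra. }
  assert (Hc : cos (acos (x / L)) = x / L) by (apply cos_acos; exact Hb).
  assert (Hs : sin (acos (x / L)) = Rabs (y / L))
    by (rewrite sin_acos, Hxy, sqrt_Rsqr_abs; [reflexivity | exact Hb]).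
  exists L. destruct (Rle_dec 0 (y / L)) as [Hy|Hy].
  - exists (acos (x / L)). split; [exact HL|].
    rewrite Rabs_right in Hs by lra.
    unfold dirv; rewrite Hc, Hs. unfold pscale; simpl. apply pt_eq; simpl; field; lra.
  - exists (- acos (x / L)). split; [exact HL|].
    rewrite Rabs_left in Hs by lra.
    unfold dirv; rewrite cos_neg, sin_neg, Hc, Hs. unfold pscale; simpl.
    apply pt_eq; simpl; field; lra.
Qed.

(* Two successive reflections in the sides through the corner [X] amount to a
   rotation about [X] by twice the angle between the sides. *)
Lemma corner (V : nat -> pt) (s s' t : nat) (al al' k k' psi psi' m m' : R) (X : pt) :
  psub (V (S s)) (V s) = pscale k (dirv al) -> k <> 0 ->
  psub (V (S s')) (V s') = pscale k' (dirv al') -> k' <> 0 ->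
  X = V s \/ X = V (S s) -> X = V s' \/ X = V (S s') ->
  dirv psi' = dirv (psi + 2 * (al' - al)) ->
  leval (Leg s (dirv psi) m) X = leval (Leg t (dirv psi') m') X ->
  leval (Leg s (dirv psi) m) (V s) < 0 -> 0 < leval (Leg s (dirv psi) m) (V (S s)) ->
  0 < leval (Leg t (dirv psi') m') (V s') ->
  leval (Leg t (dirv psi') m') (V (S s')) < 0 ->
  exists h, bounce V (Leg s (dirv psi) m) h /\ bounce V h (Leg t (dirv psi') m').
Proof.
  intros Hk Hk0 Hk' Hk0' HX HX' Hpsi HE H1 H2 H3 H4.
  set (g := dirv (2 * al - psi)).
  set (h := Leg s' (pscale (-1) g) (pdot (pscale (-1) g) X + leval (Leg s (dirv psi) m) X)).
  assert (Hh : forall z, leval h z = - leval (Leg s (dirv psi) m) X - pdot g (psub z X)).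
  { intro z. unfold h. generalize (leval (Leg s (dirv psi) m) X) g. intros y u.
    unfold leval, pdot, pscale, psub; simpl. ring. }
  assert (Hl : forall z, leval (Leg s (dirv psi) m) z =
      leval (Leg s (dirv psi) m) X + pdot (dirv psi) (psub z X))
    by (intro z; unfold leval, pdot, psub; simpl; ring).
  assert (Hl' : forall z, leval (Leg t (dirv psi') m') z =
      leval (Leg s (dirv psi) m) X + pdot (dirv psi') (psub z X))
    by (intro z; rewrite HE; unfold leval, pdot, psub; simpl; ring).
  assert (Z : forall z, psub z z = (0, 0)) by (intro; unfold psub; apply pt_eq; simpl; ring).
  assert (Z0 : forall u, pdot u (0, 0) = 0) by (intro; unfold pdot; simpl; ring).
  assert (Hsc : forall u v c, pdot u (pscale c v) = c * pdot u v)
    by (intros; unfold pdot, pscale; simpl; ring).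
  assert (Hop : forall x y, psub x y = pscale (-1) (psub y x))
    by (intros; unfold psub, pscale; apply pt_eq; simpl; ring).
  assert (D1 : pdot g (dirv al) = pdot (dirv psi) (dirv al)).
  { unfold g. rewrite !pdot_dirv. rewrite <- cos_neg. f_equal; ring. }
  assert (D2 : pdot g (dirv al') = pdot (dirv psi') (dirv al')).
  { rewrite Hpsi. unfold g. rewrite !pdot_dirv. rewrite <- cos_neg. f_equal; ring. }
  assert (E1 : leval h (V s) = - leval (Leg s (dirv psi) m) (V s)).
  { rewrite Hh, (Hl (V s)). destruct HX as [->| ->].
    - rewrite Z, !Z0. ring.
    - rewrite Hop, Hk, !Hsc, D1. ring. }
  assert (E2 : leval h (V s') = - leval (Leg t (dirv psi') m') (V s')).
  { rewrite Hh, (Hl' (V s')). destruct HX' as [->| ->].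
    - rewrite Z, !Z0. ring.
    - rewrite Hop, Hk', !Hsc, D2. ring. }
  assert (E3 : leval h (V (S s')) = - leval (Leg t (dirv psi') m') (V (S s'))).
  { rewrite Hh, (Hl' (V (S s'))). destruct HX' as [->| ->].
    - rewrite Hk', !Hsc, D2. ring.
    - rewrite Z, !Z0. ring. }
  exists h. unfold bounce.
  change (lside h) with s'. change (lside (Leg s (dirv psi) m)) with s.
  change (lgrad h) with (pscale (-1) g). change (lgrad (Leg s (dirv psi) m)) with (dirv psi).
  change (lgrad (Leg t (dirv psi') m')) with (dirv psi').
  rewrite E1, E2, E3, Hk, Hk'. split; repeat split; try lra.
  - rewrite reflect_dirv by exact Hk0. reflexivity.
  - rewrite reflect_scale. unfold g. rewrite reflect_dirv by exact Hk0'. rewrite Hpsi.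
    replace (psi + 2 * (al' - al)) with (2 * al' - (2 * al - psi)) by ring.
    unfold pscale; apply pt_eq; simpl; ring.
Qed.

(* Each of the four long legs stays at distance [L sin p cos r] from [V j] and
   [L cos p sin r] from [V (j + 2)]; they are the common tangents of the two
   circles with these radii. *)
Lemma path_diagonal (V : nat -> pt) (F : framed V) (lam eps : R) (j : nat) :
  0 < lam -> (forall i, lam <= flen F i <= 2) -> (forall i, Rabs (fdef F i) <= eps) ->
  eps <= lam * lam / 200 -> lam <= 1 ->
  fdef F (j + 4)%nat < 0 -> fdef F (j + 2)%nat < 0 -> has_short_path V.
Proof.
  intros Hlam HL HD Heps Hlam1 Hp Hr.
  set (p := - fdef F (j + 4)%nat). set (r := - fdef F (j + 2)%nat).
  assert (HD' : forall i, - eps <= fdef F i <= eps).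
  { intro i. specialize (HD i). unfold Rabs in HD. destruct (Rcase_abs _); lra. }
  assert (Hp1 : 0 < p <= eps) by (unfold p; pose proof (HD' (j + 4)%nat); lra).
  assert (Hr1 : 0 < r <= eps) by (unfold r; pose proof (HD' (j + 2)%nat); lra).
  assert (Heps1 : eps <= 1 / 200) by nra.
  pose proof PI_gt_2 as HPI.
  assert (N1 : V (j + 1)%nat = padd (V j) (pscale (flen F j) (dirv (fdir F j))))
    by (rewrite <- (framed_next V F j); f_equal; lia).
  assert (N2 : V (j + 2)%nat =
    padd (V (j + 1)%nat) (pscale (flen F (j + 1)%nat) (dirv (fdir F (j + 1)%nat))))
    by (rewrite <- (framed_next V F (j + 1)%nat); f_equal; lia).
  assert (N3 : V (j + 3)%nat =
    padd (V (j + 2)%nat) (pscale (flen F (j + 2)%nat) (dirv (fdir F (j + 2)%nat))))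
    by (rewrite <- (framed_next V F (j + 2)%nat); f_equal; lia).
  pose proof (framed_prev V F j) as N4.
  assert (T1 : fdir F (j + 1)%nat = fdir F j + PI / 2 - fdef F (j + 1)%nat)
    by (pose proof (frame_turn V F j) as T; replace (S j) with (j + 1)%nat in T by lia; exact T).
  assert (T2 : fdir F (j + 2)%nat = fdir F (j + 1)%nat + PI / 2 + r)
    by (pose proof (frame_turn V F (j + 1)%nat) as T;
        replace (S (j + 1)) with (j + 2)%nat in T by lia; unfold r; lra).
  assert (T3 : fdir F (j + 3)%nat = fdir F (j + 2)%nat + PI / 2 - fdef F (j + 3)%nat)
    by (pose proof (frame_turn V F (j + 2)%nat) as T;
        replace (S (j + 2)) with (j + 3)%nat in T by lia; exact T).
  assert (T4 : fdir F (j + 3)%nat = fdir F j + 2 * PI - PI / 2 - p)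
    by (rewrite (framed_prev_dir V F j); unfold p; ring).
  set (P := V j) in *. set (Q := V (j + 1)%nat) in *.
  set (R := V (j + 2)%nat) in *. set (S' := V (j + 3)%nat) in *.
  (* Each triangle cut off by the diagonal has twice its area at least [lam * lam / 2]. As [L <= 4],
     the vertices [Q] and [S'] are at least [lam * lam / 8] away from the diagonal, well beyond the
     legs. *)
  assert (CQ : cross (psub R P) (psub Q P) <= - (lam * lam / 2)).
  { replace (cross (psub R P) (psub Q P)) with
      (cross (pscale (flen F (j + 1)%nat) (dirv (fdir F (j + 1)%nat)))
             (pscale (flen F j) (dirv (fdir F j))))
      by (rewrite N2, N1; unfold cross, psub, padd; simpl; ring).
    rewrite cross_dirv, T1.
    replace (fdir F j - (fdir F j + PI / 2 - fdef F (j + 1)%nat)) with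
      (- (PI / 2 - fdef F (j + 1)%nat)) by ring.
    rewrite sin_neg, sin_shift.
    pose proof (cos_ge_quad (fdef F (j + 1)%nat)). pose proof (HD' (j + 1)%nat).
    pose proof (HL j). pose proof (HL (j + 1)%nat).
    assert (1 / 2 <= cos (fdef F (j + 1)%nat)) by nra.
    assert (lam * lam <= flen F (j + 1)%nat * flen F j) by (apply Rmult_le_compat; lra).
    nra. }
  assert (CS : lam * lam / 2 <= cross (psub R P) (psub S' P)).
  { replace (cross (psub R P) (psub S' P)) with
      (cross (pscale (flen F (j + 2)%nat) (dirv (fdir F (j + 2)%nat)))
             (pscale (flen F (j + 3)%nat) (dirv (fdir F (j + 3)%nat)))).
    - rewrite cross_dirv, T3.
      replace (fdir F (j + 2)%nat + PI / 2 - fdef F (j + 3)%nat - fdir F (j + 2)%nat) with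
        (PI / 2 - fdef F (j + 3)%nat) by ring.
      rewrite sin_shift.
      pose proof (cos_ge_quad (fdef F (j + 3)%nat)). pose proof (HD' (j + 3)%nat).
      pose proof (HL (j + 2)%nat). pose proof (HL (j + 3)%nat).
      assert (1 / 2 <= cos (fdef F (j + 3)%nat)) by nra.
      assert (lam * lam <= flen F (j + 2)%nat * flen F (j + 3)%nat)
        by (apply Rmult_le_compat; lra).
      nra.
    - replace (pscale (flen F (j + 2)%nat) (dirv (fdir F (j + 2)%nat))) with (psub S' R)
        by (rewrite N3; unfold psub, padd; apply pt_eq; simpl; ring).
      replace (pscale (flen F (j + 3)%nat) (dirv (fdir F (j + 3)%nat))) with (psub P S')
        by (rewrite N4; unfold psub, padd; apply pt_eq; simpl; ring).
      unfold cross, psub; simpl; ring. }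
  destruct (polar_form (psub R P)) as (L & w & HL0 & Hw).
  { assert (Hsq : 0 <= pdot (psub R P) (psub R P)) by (unfold pdot; nra).
    destruct Hsq as [Hsq|Hsq]; [exact Hsq|exfalso].
    destruct (Rplus_sqr_eq_0 _ _ (eq_sym Hsq)) as [Z1 Z2].
    unfold cross in CS. rewrite Z1, Z2 in CS. nra. }
  assert (HL4 : L <= 4).
  { assert (E : pdot (psub R P) (dirv w) = L).
    { rewrite Hw. transitivity (L * pdot (dirv w) (dirv w));
        [unfold pdot, pscale; simpl; ring | rewrite pdot_dirv, Rminus_diag, cos_0; ring]. }
    rewrite <- E.
    replace (pdot (psub R P) (dirv w)) with
      (flen F j * pdot (dirv (fdir F j)) (dirv w) +
       flen F (j + 1)%nat * pdot (dirv (fdir F (j + 1)%nat)) (dirv w))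
      by (rewrite N2, N1; unfold pdot, psub, padd, pscale; simpl; ring).
    rewrite !pdot_dirv.
    pose proof (HL j). pose proof (HL (j + 1)%nat).
    pose proof (COS_bound (fdir F j - w)). pose proof (COS_bound (fdir F (j + 1)%nat - w)).
    nra. }
  rewrite Hw in CQ, CS.
  set (xQ := pdot (dirv w) (psub Q P)). set (yQ := cross (dirv w) (psub Q P)).
  set (xS := pdot (dirv w) (psub S' P)). set (yS := cross (dirv w) (psub S' P)).
  assert (HyQ : yQ <= - (lam * lam / 8)).
  { assert (L * yQ <= - (lam * lam / 2))
      by (unfold yQ; revert CQ; unfold cross, pscale, psub; simpl; lra).
    assert (0 < lam * lam) by nra. nra. }
  assert (HyS : lam * lam / 8 <= yS).
  { assert (lam * lam / 2 <= L * yS)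
      by (unfold yS; revert CS; unfold cross, pscale, psub; simpl; lra).
    assert (0 < lam * lam) by nra. nra. }
  assert (HxQ : -2 <= xQ <= 2).
  { unfold xQ. rewrite N1.
    replace (pdot _ _) with (flen F j * pdot (dirv w) (dirv (fdir F j)))
      by (unfold pdot, psub, padd, pscale; simpl; ring).
    rewrite pdot_dirv. pose proof (HL j). pose proof (COS_bound (w - fdir F j)). nra. }
  assert (HxS : -2 <= xS <= 2).
  { unfold xS. rewrite N4.
    replace (pdot _ _) with (- (flen F (j + 3)%nat * pdot (dirv w) (dirv (fdir F (j + 3)%nat))))
      by (unfold pdot, psub, padd, pscale; simpl; ring).
    rewrite pdot_dirv. pose proof (HL (j + 3)%nat).
    pose proof (COS_bound (w - fdir F (j + 3)%nat)). nra. }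
  (* With these radii [hP - hR = L * sin (p - r)] and [hP + hR = L * sin (p + r)], so the outer and
     inner common tangents make angles [p - r] and [p + r] with the diagonal. *)
  set (hP := L * (sin p * cos r)). set (hR := L * (cos p * sin r)).
  assert (Hsp : 0 < sin p <= eps)
    by (split; [apply sin_gt_0; lra | pose proof (sin_lt_x p ltac:(lra)); lra]).
  assert (Hsr : 0 < sin r <= eps)
    by (split; [apply sin_gt_0; lra | pose proof (sin_lt_x r ltac:(lra)); lra]).
  assert (Hcp : 9 / 10 <= cos p <= 1)
    by (pose proof (cos_ge_quad p); pose proof (COS_bound p); nra).
  assert (Hcr : 9 / 10 <= cos r <= 1)
    by (pose proof (cos_ge_quad r); pose proof (COS_bound r); nra).
  assert (HhP : 0 < hP <= 4 * eps).
  { unfold hP. assert (0 < sin p * cos r <= eps) by nra. nra. }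
  assert (HhR : 0 < hR <= 4 * eps).
  { unfold hR. assert (0 < cos p * sin r <= eps) by nra. nra. }
  set (sm := sin (p - r)). set (sl := sin (p + r)).
  set (cm := cos (p - r)). set (cl := cos (p + r)).
  assert (Hsm : - eps <= sm <= eps).
  { unfold sm. rewrite sin_minus. nra. }
  assert (Hsl : - (2 * eps) <= sl <= 2 * eps).
  { unfold sl. rewrite sin_plus. nra. }
  assert (Hcm : 1 / 2 <= cm) by (unfold cm; rewrite cos_minus; nra).
  assert (Hcl : 1 / 2 <= cl) by (unfold cl; rewrite cos_plus; nra).
  assert (HLm : L * sm = hP - hR) by (unfold sm, hP, hR; rewrite sin_minus; ring).
  assert (HLl : L * sl = hP + hR) by (unfold sl, hP, hR; rewrite sin_plus; ring).
  assert (Hval : forall s b k X, leval (Leg s (dirv (w + b)) (pdot (dirv (w + b)) P - k)) X =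
      k + cos b * pdot (dirv w) (psub X P) + sin b * cross (dirv w) (psub X P)).
  { intros s b k X. unfold leval, pdot, cross, psub, dirv; simpl.
    rewrite cos_plus, sin_plus. ring. }
  assert (XP : pdot (dirv w) (psub P P) = 0) by (unfold pdot, psub; simpl; ring).
  assert (YP : cross (dirv w) (psub P P) = 0) by (unfold cross, psub; simpl; ring).
  assert (XR : pdot (dirv w) (psub R P) = L).
  { rewrite Hw. transitivity (L * pdot (dirv w) (dirv w));
      [unfold pdot, pscale; simpl; ring | rewrite pdot_dirv, Rminus_diag, cos_0; ring]. }
  assert (YR : cross (dirv w) (psub R P) = 0)
    by (rewrite Hw; unfold cross, pscale; simpl; ring).
  (* Normals of the tangents relative to the diagonal: [b1], [b3] are outer and [b2], [b4] inner.
     Consecutive ones differ, modulo [2 * PI], by the rotation of two bounces at a corner, for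
     instance [b2 - b1 = PI - 2 * p] at [P]. *)
  set (b1 := p - r - PI / 2). set (b2 := PI / 2 - (p + r)).
  set (b3 := - (p - r) - PI / 2). set (b4 := PI / 2 + (p + r)).
  assert (K1 : cos b1 = sm /\ sin b1 = - cm).
  { unfold b1, sm, cm. rewrite (cos_minus (p - r)), (sin_minus (p - r)), cos_PI2, sin_PI2. split; ring. }
  assert (K2 : cos b2 = sl /\ sin b2 = cl).
  { unfold b2, sl, cl. rewrite (cos_minus (PI / 2)), (sin_minus (PI / 2)), cos_PI2, sin_PI2. split; ring. }
  assert (K3 : cos b3 = - sm /\ sin b3 = - cm).
  { unfold b3, sm, cm. rewrite (cos_minus (- (p - r))), (sin_minus (- (p - r))), cos_PI2, sin_PI2, sin_neg, cos_neg.
    split; ring. }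
  assert (K4 : cos b4 = - sl /\ sin b4 = cl).
  { unfold b4, sl, cl. rewrite (cos_plus (PI / 2)), (sin_plus (PI / 2)), cos_PI2, sin_PI2.
    split; ring. }
  clearbody sm sl cm cl hP hR.
  destruct K1 as [K1 K1'], K2 as [K2 K2'], K3 as [K3 K3'], K4 as [K4 K4'].
  assert (Hsmall : 16 * eps < lam * lam / 8) by nra.
  assert (S1 : forall x s, -2 <= x <= 2 -> - (2 * eps) <= s <= 2 * eps ->
      - (4 * eps) <= s * x <= 4 * eps) by (intros; nra).
  set (m := fun b k => pdot (dirv (w + b)) P - k).
  set (l1 := Leg j (dirv (w + b1)) (m b1 (- hP))).
  set (l2 := Leg (j + 1) (dirv (w + b2)) (m b2 (- hP))).
  set (l3 := Leg (j + 3) (dirv (w + b3)) (m b3 hP)).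
  set (l4 := Leg (j + 2) (dirv (w + b4)) (m b4 hP)).
  assert (f1P : leval l1 P < 0 /\ leval l1 P = - hP)
    by (unfold l1, m; rewrite Hval, XP, YP; lra).
  assert (f1R : leval l1 R = - hR)
    by (unfold l1, m; rewrite Hval, XR, YR, K1; lra).
  assert (f1Q : 0 < leval l1 Q).
  { unfold l1, m. rewrite Hval, K1, K1'. fold xQ yQ.
    pose proof (S1 xQ sm HxQ ltac:(lra)). nra. }
  assert (f2P : leval l2 P = - hP) by (unfold l2, m; rewrite Hval, XP, YP; lra).
  assert (f2R : leval l2 R = hR) by (unfold l2, m; rewrite Hval, XR, YR, K2; lra).
  assert (f2Q : leval l2 Q < 0).
  { unfold l2, m. rewrite Hval, K2, K2'. fold xQ yQ.
    pose proof (S1 xQ sl HxQ Hsl). nra. }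
  assert (f2S : 0 < leval l2 S').
  { unfold l2, m. rewrite Hval, K2, K2'. fold xS yS.
    pose proof (S1 xS sl HxS Hsl). nra. }
  assert (f3P : leval l3 P = hP) by (unfold l3, m; rewrite Hval, XP, YP; lra).
  assert (f3R : leval l3 R = hR) by (unfold l3, m; rewrite Hval, XR, YR, K3; lra).
  assert (f3S : leval l3 S' < 0).
  { unfold l3, m. rewrite Hval, K3, K3'. fold xS yS.
    pose proof (S1 xS sm HxS ltac:(lra)). nra. }
  assert (f4P : leval l4 P = hP) by (unfold l4, m; rewrite Hval, XP, YP; lra).
  assert (f4R : leval l4 R = - hR) by (unfold l4, m; rewrite Hval, XR, YR, K4; lra).
  assert (f4S : 0 < leval l4 S').
  { unfold l4, m. rewrite Hval, K4, K4'. fold xS yS.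
    pose proof (S1 xS sl HxS Hsl). nra. }
  assert (f4Q : leval l4 Q < 0).
  { unfold l4, m. rewrite Hval, K4, K4'. fold xQ yQ.
    pose proof (S1 xQ sl HxQ Hsl). nra. }
  assert (SQ : V (S j) = Q) by (unfold Q; f_equal; lia).
  assert (SR : V (S (j + 1)) = R) by (unfold R; f_equal; lia).
  assert (SS : V (S (j + 2)) = S') by (unfold S'; f_equal; lia).
  assert (SP : V (S (j + 3)) = P).
  { replace (S (j + 3)) with (j + 4)%nat by lia. apply (frame_period V F). }
  assert (Hne : forall i, flen F i <> 0) by (intro i; pose proof (HL i); lra).
  destruct (corner V j (j + 3) (j + 1) _ _ _ _ (w + b1) (w + b2) (m b1 (- hP)) (m b2 (- hP)) P
    (frame_side V F j) (Hne _) (frame_side V F (j + 3)%nat) (Hne _)) as (h12 & B1 & B1');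
    fold l1 l2 P S'; rewrite ?SQ, ?SP; auto; try lra.
  { rewrite T4, <- dirv_add_2PI. f_equal. unfold b1, b2. field. }
  destruct (corner V (j + 1) (j + 2) (j + 3) _ _ _ _ (w + b2) (w + b3)
    (m b2 (- hP)) (m b3 hP) R
    (frame_side V F (j + 1)%nat) (Hne _) (frame_side V F (j + 2)%nat) (Hne _))
    as (h23 & B2 & B2'); fold l2 l3 Q R; rewrite ?SR, ?SS; auto; try lra.
  { rewrite T2, <- dirv_add_2PI. f_equal. unfold b2, b3. field. }
  destruct (corner V (j + 3) j (j + 2) _ _ _ _ (w + b3) (w + b4) (m b3 hP) (m b4 hP) P
    (frame_side V F (j + 3)%nat) (Hne _) (frame_side V F j) (Hne _)) as (h34 & B3 & B3');
    fold l3 l4 P S'; rewrite ?SQ, ?SP; auto; try lra.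
  { rewrite T4, <- (dirv_add_2PI (w + b3 + _)), <- (dirv_add_2PI (w + b3 + _ + _)).
    f_equal. unfold b3, b4. field. }
  destruct (corner V (j + 2) (j + 1) j _ _ _ _ (w + b4) (w + b1) (m b4 hP) (m b1 (- hP)) R
    (frame_side V F (j + 2)%nat) (Hne _) (frame_side V F (j + 1)%nat) (Hne _))
    as (h41 & B4 & B4'); fold l4 l1 Q R; rewrite ?SR, ?SS; auto; try lra.
  { rewrite T2. f_equal. unfold b4, b1. field. }
  exists l1, (h12 :: l2 :: h23 :: l3 :: h34 :: l4 :: h41 :: nil).
  split; [simpl; lia|]. cbn [bounces]. tauto.
Qed.

(** * Neighbourhood of the rectangle line *)

(** The acute vertex is [j + 1], its neighbour [j + 2]. The apex angle is minus the sum of their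
    defects, so the last hypothesis reads [dev <= tau]. *)
Lemma path_wedge_left (V : nat -> pt) (F : framed V) (lam : R) (j : nat) :
  (forall i, lam <= flen F i <= 2) ->
  160 * - (fdef F (j + 1)%nat + fdef F (j + 2)%nat) <= lam ->
  fdef F (j + 1)%nat < 0 -> 2 * fdef F (j + 2)%nat <= - fdef F (j + 1)%nat ->
  has_short_path V.
Proof.
  intros HL Hs H1 H2.
  pose proof (frame_turn V F j) as T1. pose proof (frame_turn V F (S j)) as T2.
  replace (j + 1)%nat with (S j) in * by lia. replace (j + 2)%nat with (S (S j)) in * by lia.
  apply (make_wedge V 1 (fdir F j) (- (fdef F (S j) + fdef F (S (S j)))) (fdef F (S (S j)))
    (flen F (S j)) (flen F j) (flen F (S (S j))) lam
    (V (S j)) (V (S (S j))) (V j) (V (S (S (S j)))) j (S (S j)) (S j));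
    try (left; repeat split; reflexivity); auto; try lra.
  - rewrite (frame_side V F). unfold ray. do 2 f_equal. ring.
  - transitivity (pscale (-1) (psub (V (S (S (S j)))) (V (S (S j)))));
      [unfold psub, pscale; apply pt_eq; simpl; ring|].
    rewrite (frame_side V F). unfold ray. rewrite T2, T1.
    replace (fdir F j + PI / 2 - fdef F (S j) + PI / 2 - fdef F (S (S j))) with
      (fdir F j + 1 * - (fdef F (S j) + fdef F (S (S j))) + PI) by field.
    rewrite dirv_add_PI. unfold pscale; apply pt_eq; simpl; ring.
  - rewrite (frame_side V F). unfold ray. do 2 f_equal. rewrite T1. field.
Qed.

(** Mirror image of the left case, with acute vertex [j + 2]; the frame has orientation [-1]. *)
Lemma path_wedge_right (V : nat -> pt) (F : framed V) (lam : R) (j : nat) :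
  (forall i, lam <= flen F i <= 2) ->
  160 * - (fdef F (j + 1)%nat + fdef F (j + 2)%nat) <= lam ->
  fdef F (j + 2)%nat < 0 -> 2 * fdef F (j + 1)%nat <= - fdef F (j + 2)%nat ->
  has_short_path V.
Proof.
  intros HL Hs H1 H2.
  pose proof (frame_turn V F j) as T1. pose proof (frame_turn V F (S j)) as T2.
  replace (j + 1)%nat with (S j) in * by lia. replace (j + 2)%nat with (S (S j)) in * by lia.
  apply (make_wedge V (-1) (fdir F (S (S j)) + PI)
    (- (fdef F (S j) + fdef F (S (S j)))) (fdef F (S j))
    (flen F (S j)) (flen F (S (S j))) (flen F j) lam
    (V (S (S j))) (V (S j)) (V (S (S (S j)))) (V j) (S (S j)) j (S j));
    try (right; repeat split; reflexivity); auto; try lra.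
  - transitivity (pscale (-1) (psub (V (S (S (S j)))) (V (S (S j)))));
      [unfold psub, pscale; apply pt_eq; simpl; ring|].
    rewrite (frame_side V F). unfold ray.
    replace (fdir F (S (S j)) + PI + -1 * 0) with (fdir F (S (S j)) + PI) by ring.
    rewrite dirv_add_PI. unfold pscale; apply pt_eq; simpl; ring.
  - rewrite (frame_side V F). unfold ray. f_equal. rewrite T2, T1, <- dirv_add_2PI.
    f_equal. field.
  - transitivity (pscale (-1) (psub (V (S (S j))) (V (S j))));
      [unfold psub, pscale; apply pt_eq; simpl; ring|].
    rewrite (frame_side V F). unfold ray.
    replace (fdir F (S (S j)) + PI + -1 * (- (fdef F (S j) + fdef F (S (S j))) + fdef F (S j) + PI / 2))
      with (fdir F (S j) + PI) by (rewrite T2; field).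
    rewrite dirv_add_PI. unfold pscale; apply pt_eq; simpl; ring.
Qed.

Lemma near_rectangle_path (V : nat -> pt) (F : framed V) (lam eps : R) :
  0 < lam <= 1 -> (forall i, lam <= flen F i <= 2) -> (forall i, Rabs (fdef F i) <= eps) ->
  eps <= lam * lam / 400 -> has_short_path V.
Proof.
  intros Hlam HL HD Heps.
  assert (HD' : forall i, - eps <= fdef F i <= eps).
  { intro i. specialize (HD i). unfold Rabs in HD. destruct (Rcase_abs _); lra. }
  assert (Hs : forall i k, 160 * - (fdef F i + fdef F k) <= lam).
  { intros i k. pose proof (HD' i). pose proof (HD' k). nra. }
  pose proof (fun j => path_wedge_left V F lam j HL (Hs _ _)) as WL.
  pose proof (fun j => path_wedge_right V F lam j HL (Hs _ _)) as WR.
  pose proof (fun j => path_diagonal V F lam eps j ltac:(lra) HL HD ltac:(nra) ltac:(lra)) as WD.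
  pose proof (frame_full V F 0%nat) as F0. pose proof (frame_full V F 1%nat) as F1.
  pose proof (frame_turn V F 0%nat) as T0. pose proof (frame_turn V F 1%nat) as T1.
  pose proof (frame_turn V F 2%nat) as T2. pose proof (frame_turn V F 3%nat) as T3.
  pose proof (frame_turn V F 4%nat) as T4.
  pose proof (path_rectangle V F) as WR0.
  pose proof (WL 0%nat) as L0. pose proof (WL 1%nat) as L1. pose proof (WL 2%nat) as L2.
  pose proof (WL 3%nat) as L3. pose proof (WR 0%nat) as R0. pose proof (WR 1%nat) as R1.
  pose proof (WR 2%nat) as R2. pose proof (WR 3%nat) as R3.
  pose proof (WD 0%nat) as D0. pose proof (WD 1%nat) as D1.
  simpl in *.
  set (d1 := fdef F 1%nat) in *. set (d2 := fdef F 2%nat) in *.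
  set (d3 := fdef F 3%nat) in *. set (d4 := fdef F 4%nat) in *.
  assert (E5 : fdef F 5%nat = d1) by lra. rewrite E5 in *.
  assert (Hsum : d1 + d2 + d3 + d4 = 0) by lra.
  clear - L0 L1 L2 L3 R0 R1 R2 R3 D0 D1 WR0 Hsum.
  (* Opposite negative defects give [D0] or [D1], adjacent ones a left wedge, and no negative defect
     forces all to vanish. The four remaining cases have a single acute vertex; its neighbour of
     smaller defect is used. *)
  destruct (Rlt_dec d1 0), (Rlt_dec d2 0), (Rlt_dec d3 0), (Rlt_dec d4 0);
    try (apply D0; lra); try (apply D1; lra);
    try (apply L0; lra); try (apply L1; lra); try (apply L2; lra); try (apply L3; lra);
    try (apply WR0; lra).
  - destruct (Rle_dec d2 d4); [apply L0; lra | apply R3; lra].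
  - destruct (Rle_dec d3 d1); [apply L1; lra | apply R0; lra].
  - destruct (Rle_dec d4 d2); [apply L2; lra | apply R1; lra].
  - destruct (Rle_dec d1 d3); [apply L3; lra | apply R2; lra].
Qed.

(** * The frame of the quadrilateral with given angles *)

Definition pick4 {T : Type} (x0 x1 x2 x3 : T) (i : nat) : T :=
  match (i mod 4)%nat with 0%nat => x0 | 1%nat => x1 | 2%nat => x2 | _ => x3 end.

Lemma mod4_cases (i : nat) : exists k,
  i = (0 + k * 4)%nat \/ i = (1 + k * 4)%nat \/ i = (2 + k * 4)%nat \/ i = (3 + k * 4)%nat.
Proof.
  exists (i / 4)%nat. pose proof (Nat.div_mod_eq i 4).
  pose proof (Nat.mod_upper_bound i 4 ltac:(lia)). lia.
Qed.

Lemma pick4_add {T : Type} (x0 x1 x2 x3 : T) (r k : nat) :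
  pick4 x0 x1 x2 x3 (r + k * 4) = pick4 x0 x1 x2 x3 r.
Proof. unfold pick4. rewrite Nat.Div0.mod_add. reflexivity. Qed.

Lemma dirv_add_turns (t : R) (k : nat) : dirv (t + INR k * (2 * PI)) = dirv t.
Proof.
  unfold dirv. replace (t + INR k * (2 * PI)) with (t + 2 * INR k * PI) by ring.
  rewrite cos_period, sin_period. reflexivity.
Qed.

(** Law of sines in the two triangles, whose common side, the diagonal, has length 1. *)
Definition vert_len (a b c d : R) : nat -> R :=
  pick4 (sin b / sin (a + b)) (sin a / sin (a + b)) (sin d / sin (c + d)) (sin c / sin (c + d)).
(** The term with [i / 4] lifts directions from the circle to the line: each round adds [2 * PI]. *)
Definition vert_dir (a b c d : R) (i : nat) : R :=
  pick4 (- a) b (PI - c) (PI + d) i + INR (i / 4) * (2 * PI).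
Definition vert_def (a b c d : R) : nat -> R :=
  pick4 (a + d - PI / 2) (PI / 2 - (a + b)) (b + c - PI / 2) (PI / 2 - (c + d)).

Lemma div4_add (r k : nat) : (r < 4)%nat -> ((r + k * 4) / 4 = k)%nat.
Proof.
  intro. rewrite Nat.div_add, Nat.div_small by lia. reflexivity.
Qed.

Lemma vert_add (a b c d : R) (r k : nat) : vert a b c d (r + k * 4) = vert a b c d r.
Proof. unfold vert. rewrite Nat.Div0.mod_add. reflexivity. Qed.

Lemma framed_vert (a b c d : R) :
  0 < a < PI -> 0 < b < PI -> 0 < c < PI -> 0 < d < PI -> a + b < PI -> c + d < PI ->
  exists F : framed (vert a b c d),
    flen F = vert_len a b c d /\ fdef F = vert_def a b c d.
Proof.
  intros Ha Hb Hc Hd Hab Hcd.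
  assert (Sab : 0 < sin (a + b)) by (apply sin_gt_0; lra).
  assert (Scd : 0 < sin (c + d)) by (apply sin_gt_0; lra).
  unshelve refine (ex_intro _ (Framed _ (vert_len a b c d) (vert_dir a b c d)
    (vert_def a b c d) _ _ _ _ _) (conj eq_refl eq_refl)).
  - intro i. destruct (mod4_cases i) as (k & [-> | [-> | [-> | ->]]]).
    + change (S (0 + k * 4)) with (1 + k * 4)%nat. unfold vert_len, vert_dir.
      rewrite !vert_add, !pick4_add, div4_add, dirv_add_turns by lia.
      unfold vert, pick4, vQ, vP, dirv, psub, pscale; simpl. rewrite cos_neg, sin_neg.
      apply pt_eq; simpl; field; lra.
    + change (S (1 + k * 4)) with (2 + k * 4)%nat. unfold vert_len, vert_dir.
      rewrite !vert_add, !pick4_add, div4_add, dirv_add_turns by lia.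
      unfold vert, pick4, vQ, vR, dirv, psub, pscale; simpl. rewrite sin_plus in *.
      apply pt_eq; simpl; field; lra.
    + change (S (2 + k * 4)) with (3 + k * 4)%nat. unfold vert_len, vert_dir.
      rewrite !vert_add, !pick4_add, div4_add, dirv_add_turns by lia.
      unfold vert, pick4, vR, vS, dirv, psub, pscale; simpl.
      rewrite cos_minus, sin_minus, cos_PI, sin_PI. rewrite (sin_plus c d) in *.
      apply pt_eq; simpl; field; lra.
    + change (S (3 + k * 4)) with (0 + S k * 4)%nat. unfold vert_len, vert_dir.
      rewrite !vert_add, !pick4_add, div4_add, dirv_add_turns by lia.
      unfold vert, pick4, vP, vS, dirv, psub, pscale; simpl.
      rewrite (cos_plus PI), (sin_plus PI), cos_PI, sin_PI.
      apply pt_eq; simpl; field; lra.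
  - intro i. unfold vert_dir, vert_def.
    destruct (mod4_cases i) as (k & [-> | [-> | [-> | ->]]]).
    + change (S (0 + k * 4)) with (1 + k * 4)%nat.
      rewrite !pick4_add, !div4_add by lia. unfold pick4; simpl. lra.
    + change (S (1 + k * 4)) with (2 + k * 4)%nat.
      rewrite !pick4_add, !div4_add by lia. unfold pick4; simpl. lra.
    + change (S (2 + k * 4)) with (3 + k * 4)%nat.
      rewrite !pick4_add, !div4_add by lia. unfold pick4; simpl. lra.
    + change (S (3 + k * 4)) with (0 + S k * 4)%nat.
      rewrite !pick4_add, !div4_add, S_INR by lia. unfold pick4; simpl. lra.
  - intro i. exact (vert_add a b c d i 1).
  - intro i. unfold vert_len, pick4.
    pose proof (sin_gt_0 a ltac:(lra) ltac:(lra)). pose proof (sin_gt_0 b ltac:(lra) ltac:(lra)).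
    pose proof (sin_gt_0 c ltac:(lra) ltac:(lra)). pose proof (sin_gt_0 d ltac:(lra) ltac:(lra)).
    destruct (i mod 4)%nat as [|[|[|]]]; apply Rdiv_lt_0_compat; assumption.
  - intro i. unfold vert_dir. rewrite (pick4_add _ _ _ _ i 1 : pick4 _ _ _ _ (i + 4) = _).
    replace (i + 4)%nat with (i + 1 * 4)%nat by lia.
    rewrite Nat.div_add, Nat.add_1_r, S_INR by lia. ring.
Qed.

(** A lower bound for the sides of nearby quadrilaterals: the angles stay above half of [a] or half
    of [PI / 2 - a], and the denominators in [vert_len] are at most 1. *)
Definition side_bound (a : R) : R := Rmin (sin (a / 2)) (sin ((PI / 2 - a) / 2)).

(** A defect involves the deviations of two angles, so it stays below [2 * radius a], which is the
    bound [lam * lam / 400] of [near_rectangle_path] for [lam = side_bound a]. *)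
Definition radius (a : R) : R := side_bound a * side_bound a / 800.

Definition near_rect_line (a b c d : R) : Prop :=
  exists a0, 0 < a0 < PI / 2 /\
    Rabs (a - a0) < radius a0 /\ Rabs (b - (PI / 2 - a0)) < radius a0 /\
    Rabs (c - a0) < radius a0 /\ Rabs (d - (PI / 2 - a0)) < radius a0.

Lemma ball_open (x y r : R) : Rabs (x - y) < r ->
  exists e, 0 < e /\ forall x', Rabs (x' - x) < e -> Rabs (x' - y) < r.
Proof.
  intro H. exists (r - Rabs (x - y)). split; [lra|]. intros x' H'.
  replace (x' - y) with ((x' - x) + (x - y)) by ring.
  eapply Rle_lt_trans; [apply Rabs_triang|]. lra.
Qed.

Lemma near_rect_line_open : open4 near_rect_line.
Proof.
  intros a b c d (a0 & H0 & Ha & Hb & Hc & Hd).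
  destruct (ball_open _ _ _ Ha) as (ea & Pa & Fa).
  destruct (ball_open _ _ _ Hb) as (eb & Pb & Fb).
  destruct (ball_open _ _ _ Hc) as (ec & Pc & Fc).
  destruct (ball_open _ _ _ Hd) as (ed & Pd & Fd).
  exists (Rmin (Rmin ea eb) (Rmin ec ed)).
  split; [repeat apply Rmin_glb_lt; assumption|].
  intros a' b' c' d' Ha' Hb' Hc' Hd'.
  assert (Hm : forall x, x < Rmin (Rmin ea eb) (Rmin ec ed) -> x < ea /\ x < eb /\ x < ec /\ x < ed).
  { intros x Hx. pose proof (Rmin_l (Rmin ea eb) (Rmin ec ed)).
    pose proof (Rmin_r (Rmin ea eb) (Rmin ec ed)). pose proof (Rmin_l ea eb).
    pose proof (Rmin_r ea eb). pose proof (Rmin_l ec ed). pose proof (Rmin_r ec ed). lra. }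
  exists a0. split; [exact H0|].
  repeat split; [apply Fa | apply Fb | apply Fc | apply Fd]; apply Hm; assumption.
Qed.

Lemma side_bound_pos (a : R) : 0 < a < PI / 2 ->
  0 < side_bound a <= 1 /\ side_bound a <= a / 2 /\ side_bound a <= (PI / 2 - a) / 2 /\
  side_bound a <= sin (a / 2) /\ side_bound a <= sin ((PI / 2 - a) / 2).
Proof.
  intro Ha. unfold side_bound.
  pose proof (Rmin_l (sin (a / 2)) (sin ((PI / 2 - a) / 2))).
  pose proof (Rmin_r (sin (a / 2)) (sin ((PI / 2 - a) / 2))).
  pose proof (sin_lt_x (a / 2) ltac:(lra)). pose proof (sin_lt_x ((PI / 2 - a) / 2) ltac:(lra)).
  pose proof (SIN_bound (a / 2)).
  assert (0 < Rmin (sin (a / 2)) (sin ((PI / 2 - a) / 2)))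
    by (apply Rmin_glb_lt; apply sin_gt_0; lra).
  lra.
Qed.

Lemma near_angle (x x0 : R) : 0 < x0 < PI / 2 ->
  Rabs (x - x0) < x0 / 2 -> Rabs (x - x0) < (PI / 2 - x0) / 2 -> 
  sin (x0 / 2) <= sin x <= 1.
Proof.
  intros H0 H1 H2. apply Rabs_def2 in H1. apply Rabs_def2 in H2.
  split; [left; apply sin_increasing_1; lra | apply SIN_bound].
Qed.

Lemma quotient_bound (x y l : R) : 0 < l -> l <= x <= 1 -> 1 / 2 <= y <= 1 -> l <= x / y <= 2.
Proof.
  intros Hl Hx Hy. split; apply Rmult_le_reg_r with y; try lra;
    unfold Rdiv; rewrite Rmult_assoc, Rinv_l by lra; nra.
Qed.

Lemma near_rect_line_path (a b c d : R) : near_rect_line a b c d ->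
  convex_quad (vert a b c d) /\ has_short_path (vert a b c d).
Proof.
  intros (a0 & H0 & Ha & Hb & Hc & Hd).
  destruct (side_bound_pos a0 H0) as (Hl & Hl1 & Hl2 & Hl3 & Hl4).
  unfold radius in *. set (l := side_bound a0) in *.
  set (e := l * l / 800) in *.
  assert (He : 0 < e <= l / 800) by (unfold e; nra).
  set (b0 := PI / 2 - a0) in *.
  assert (H0' : 0 < b0 < PI / 2) by (unfold b0; lra).
  assert (Na : sin (a0 / 2) <= sin a <= 1) by (apply near_angle; fold b0; lra).
  assert (Nc : sin (a0 / 2) <= sin c <= 1) by (apply near_angle; fold b0; lra).
  assert (Nb : sin (b0 / 2) <= sin b <= 1)
    by (apply near_angle; try replace (PI / 2 - b0) with a0 by (unfold b0; ring); lra).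
  assert (Nd : sin (b0 / 2) <= sin d <= 1)
    by (apply near_angle; try replace (PI / 2 - b0) with a0 by (unfold b0; ring); lra).
  apply Rabs_def2 in Ha, Hb, Hc, Hd.
  assert (Hab0 : a0 + b0 = PI / 2) by (unfold b0; ring). clearbody b0.
  assert (Hsin : forall x, - (1 / 100) < x - PI / 2 < 1 / 100 -> 1 / 2 <= sin x <= 1).
  { intros x Hx. split; [|apply SIN_bound].
    replace x with (PI / 2 + (x - PI / 2)) by ring. rewrite sin_cos.
    replace (PI / 2 + (PI / 2 + (x - PI / 2))) with ((x - PI / 2) + PI) by field.
    rewrite neg_cos. pose proof (cos_ge_quad (x - PI / 2)). nra. }
  pose proof PI_gt_2.
  assert (Sab := Hsin (a + b) ltac:(lra)). assert (Scd := Hsin (c + d) ltac:(lra)).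
  destruct (framed_vert a b c d) as (F & FL & FD); try lra.
  assert (HD : forall i, Rabs (fdef F i) <= 2 * e).
  { intro i. rewrite FD. apply Rabs_le. unfold vert_def, pick4.
    destruct (i mod 4)%nat as [|[|[|]]]; lra. }
  split.
  - apply (framed_convex _ F). intro i. specialize (HD i). lra.
  - apply (near_rectangle_path _ F l (2 * e)); [exact Hl | | exact HD | unfold e; lra].
    intro i. rewrite FL. unfold vert_len, pick4.
    destruct (i mod 4)%nat as [|[|[|]]]; apply quotient_bound; lra.
Qed.

(* An open set of Q (= V ∩ Q with V open in R^4) containing the rectangle
   line, contained in the union of finitely many orbit tiles. *)
Theorem theorem2p2p5 :
  exists (V : R -> R -> R -> R -> Prop) (Ws : list (list nat)),
    open4 V /\
    (forall a b c d, rect_line a b c d -> V a b c d) /\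
    (forall a b c d, V a b c d -> inQ a b c d ->
       exists W, In W Ws /\ in_orbit_tile W a b c d).
Proof.
  exists near_rect_line, (words (2 * 28)). split; [|split].
  - apply near_rect_line_open.
  - intros a b c d (HQ & <- & <- & Hab). destruct HQ as (Ha & Hb & _).
    assert (Ha0 : 0 < a < PI / 2) by lra.
    destruct (side_bound_pos a Ha0) as [Hl _].
    assert (Hr : 0 < radius a) by (unfold radius; nra).
    exists a. split; [exact Ha0|]. replace b with (PI / 2 - a) by lra.
    rewrite !Rminus_diag, Rabs_R0. auto.
  - intros a b c d HV HQ.
    destruct (near_rect_line_path a b c d HV) as (Hc & l & ls & Hls & Hb).
    exact (tile_of_bounces a b c d l ls 28 HQ Hc Hb Hls).
Qed.
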